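(* Suppose that each $f_i:\mathbb R^d\to\mathbb R$ is continuously differentiable, that there is $L>0$ with $\|\nabla f_i(x)-\nabla f_i(y)\|\le L\|x-y\|$ for all $x,y\in\mathbb R^d$ and all $i$, and that $f$ is bounded below, with optimal value $f^\star=\inf f\in\mathbb R$. Suppose also that the random variables $\xi_i^{(k)}$, $k\in\mathbb N$, $i=1,\dots,n$, are independent of each other, that $\mathbb E_k[\nabla F_i(x_i^{(k)};\xi_i^{(k)})]=\nabla f_i(x_i^{(k)})$ for all $k,i$, and that there is $\sigma>0$ such that $\mathbb E_k[\|\nabla F_i(x_i^{(k)};\xi_i^{(k)})-\nabla f_i(x_i^{(k)})\|^2]\le\sigma^2$ for all $k,i$. Let the mixing matrices $\{W^{(l)}\}_{l=0}^{\tau-1}\subset\mathbb R^{n\times n}$ have the finite-time consensus property with parameter $\tau\ge1$. Then there exist constants $\gamma_6,\gamma_7,\gamma_8>0$, depending only on $\mathbb E[f(\bar x^{(0)})-f^\star]$ (and not on $T,n,\tau,L,\sigma$), such that for every integer $T\ge\tau$ the following holds. Let $$\alpha=\min\Big\{\big(\tfrac1{c_1T}\big)^{1/2},\ \big(\tfrac1{c_2T}\big)^{1/3},\ \tfrac1{4\sqrt6\,\tau^2L}\Big\},\qquad c_1=\frac{L\sigma^2}{n},\quad c_2=\tau^3L^2\sigma^2,$$ and suppose that a warm-up strategy (e.g. exact averaging by AllReduce) is applied so that all agents' parameters and tracking variables in the first period are the same, i.e. $\sum_{k=0}^{\tau}\mathbb E\|\hat{\boldsymbol x}^{(k)}\|^2=0$.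 Then the sequence $\{\boldsymbol x^{(k)}\}$ generated by GT-FT with stepsize $\alpha$ satisfies $$\frac1{T+1}\sum_{k=0}^T\Big(\mathbb E\|\overline{\nabla f}(\boldsymbol x^{(k)})\|^2+\mathbb E\|\nabla f(\bar x^{(k)})\|^2\Big)\le\frac{\gamma_6\tau^2L}{T}+\gamma_7\tau\Big(\frac{L\sigma}{T}\Big)^{2/3}+\gamma_8\Big(\frac{L\sigma^2}{nT}\Big)^{1/2}.$$
   Context: Problem: minimize $f(x)=\frac1n\sum_{i=1}^nf_i(x)$ over $x\in\mathbb R^d$, where $f_i(x)=\mathbb E_{\xi_i}[F_i(x;\xi_i)]$ and $\xi_i$ is a random variable on a probability space $(\Omega_i,\mathcal F_i,\mathbb P_i)$. $\|\cdot\|$ is the Euclidean norm and $\mathbf 1$ the all-ones vector in $\mathbb R^n$. No convexity is assumed. Finite-time consensus property with parameter $\tau\ge1$: all $W^{(0)},\dots,W^{(\tau-1)}\in\mathbb R^{n\times n}$ are doubly stochastic and $W^{(\tau-1)}W^{(\tau-2)}\cdots W^{(0)}=\frac1n\mathbf 1\mathbf 1^{\mathsf T}$. Algorithm GT-FT with stepsize $\alpha>0$: given initial points $x_i^{(0)}\in\mathbb R^d$, set $g_i^{(0)}=\nabla F_i(x_i^{(0)};\xi_i^{(0)})$, $i=1,\dots,n$. Stack $\boldsymbol x^{(k)}=(x_1^{(k)},\dots,x_n^{(k)})\in\mathbb R^{dn}$ (the agents' parameters), $\boldsymbol g^{(k)}=(g_1^{(k)},\dots,g_n^{(k)})\in\mathbb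 R^{dn}$ (the tracking variables), $\nabla\boldsymbol F^{(k)}=(\nabla F_1(x_1^{(k)};\xi_1^{(k)}),\dots,\nabla F_n(x_n^{(k)};\xi_n^{(k)}))$, where gradients of $F_i$ are in the first argument. For $k=0,1,2,\dots$, with $\boldsymbol W^{(k)}=W^{(\mathrm{mod}(k,\tau))}\otimes I_d$ (the matrices are cycled through periodically in the order $W^{(0)},W^{(1)},\dots,W^{(\tau-1)}$), $$\boldsymbol x^{(k+1)}=\boldsymbol W^{(k)}(\boldsymbol x^{(k)}-\alpha\boldsymbol g^{(k)}),\qquad \boldsymbol g^{(k+1)}=\boldsymbol W^{(k)}\boldsymbol g^{(k)}+\nabla\boldsymbol F^{(k+1)}-\nabla\boldsymbol F^{(k)}.$$ Notation: $\bar x^{(k)}=\frac1n\sum_{i=1}^nx_i^{(k)}$, $\hat{\boldsymbol x}^{(k)}=\boldsymbol x^{(k)}-\mathbf 1\otimes\bar x^{(k)}$, $\overline{\nabla f}(\boldsymbol x^{(k)})=\frac1n\sum_{i=1}^n\nabla f_i(x_i^{(k)})$. Let $\mathcal F^{(k)}$ be the $\sigma$-algebra generated by the initial conditions and $\boldsymbol x^{(1)},\dots,\boldsymbol x^{(k)}$, and $\mathbb E_k[\cdot]=\mathbb E[\cdot\mid\mathcal F^{(k)}]$. *)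

(* Defs.v *)
From HB Require Import structures.
From mathcomp Require Import all_boot all_order all_algebra.
From mathcomp Require Import all_classical all_reals all_analysis.

Set Implicit Arguments.
Unset Strict Implicit.
Unset Printing Implicit Defensive.
Import Order.TTheory GRing.Theory Num.Theory.
Import numFieldNormedType.Exports.

Local Open Scope classical_set_scope.
Local Open Scope ring_scope.

(* A stacked vector (x_1, ..., x_n) in R^(dn) is the matrix whose i-th row is
   x_i in R^d. Under this identification (W (x) I_d) x is W *m x, and 1 (x) y is
   const_mx 1 *m y. *)

(* The norm the library puts on matrices is the sup norm; it induces the same
   topology, hence the same [differentiable] and [continuous], but the
   inequalities below are about the Euclidean one. For a stacked vector this is
   the Euclidean norm of R^(dn). *)
Definition enorm (R : realType) (m p : nat) (A : 'M[R]_(m, p)) : R :=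
  Num.sqrt (\sum_i \sum_j A i j ^+ 2).

Definition grad (R : realType) (d : nat) (f : 'rV[R]_d -> R) (x : 'rV[R]_d) :
    'rV[R]_d :=
  \row_j 'D_(delta_mx 0 j) f x.

Definition avg (R : realType) (n d : nat) (X : 'M[R]_(n, d)) : 'rV[R]_d :=
  n%:R^-1 *: \sum_i row i X.

Definition deviation (R : realType) (n d : nat) (X : 'M[R]_(n, d)) :
    'M[R]_(n, d) :=
  X - const_mx 1 *m avg X.

Definition mean_fun (R : realType) (n d : nat) (f : 'I_n -> 'rV[R]_d -> R)
    (x : 'rV[R]_d) : R :=
  n%:R^-1 * \sum_i f i x.

Definition mean_grad (R : realType) (n d : nat) (f : 'I_n -> 'rV[R]_d -> R)
    (X : 'M[R]_(n, d)) : 'rV[R]_d :=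
  n%:R^-1 *: \sum_i grad (f i) (row i X).

Definition stoch_grad (R : realType) (n d : nat) (S : 'I_n -> Type)
    (F : forall i, 'rV[R]_d -> S i -> R) (s : forall i, S i)
    (X : 'M[R]_(n, d)) : 'M[R]_(n, d) :=
  \matrix_i grad (fun y => F i y (s i)) (row i X).

Definition doubly_stochastic (R : realType) (n : nat) (W : 'M[R]_n) : Prop :=
  [/\ forall i j, 0 <= W i j,
      forall i, \sum_j W i j = 1 &
      forall j, \sum_i W i j = 1].

(* Only W 0, ..., W (tau - 1) matter. The index list is
   [:: tau - 1; ...; 1; 0], so that the product is W (tau-1) ... W 1 W 0. *)
Definition finite_time_consensus (R : realType) (n tau : nat)
    (W : nat -> 'M[R]_n) : Prop :=
  (forall l, (l < tau)%N -> doubly_stochastic (W l)) /\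
  \big[mulmx/1%:M]_(l <- rev (iota 0 tau)) W l = const_mx n%:R^-1.

(* [G k X] stands for the stacked stochastic gradients at step k, evaluated at
   the stacked point X. The matrices V describe the warm-up: each pair
   (x k, g k) of the first period, k <= tau, is combined once more across the
   agents by V k. With V k = 1%:M for all k this is GT-FT verbatim; with
   V k = const_mx n%:R^-1 it is exact averaging (AllReduce), after which all
   agents hold the same parameters and tracking variables. *)

Definition warm_up (R : realType) (n tau : nat) (V : nat -> 'M[R]_n) : Prop :=
  (forall k, (k <= tau)%N -> doubly_stochastic (V k)) /\
  (forall k, (tau < k)%N -> V k = 1%:M).

Definition gtft (R : realType) (n d tau : nat) (W V : nat -> 'M[R]_n)
    (alpha : R) (G : nat -> 'M[R]_(n, d) -> 'M[R]_(n, d))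
    (x g : nat -> 'M[R]_(n, d)) : Prop :=
  g 0%N = V 0%N *m G 0%N (x 0%N) /\
  forall k,
    x k.+1 = V k.+1 *m (W (k %% tau)%N *m (x k - alpha *: g k)) /\
    g k.+1 = V k.+1 *m
      (W (k %% tau)%N *m g k + G k.+1 (x k.+1) - G k (x k)).

Definition mutually_independent (d : measure_display) (T : measurableType d)
    (R : realType) (P : probability T R) (I : eqType)
    (G : I -> set (set T)) : Prop :=
  forall (s : seq I) (A : I -> set T), uniq s ->
    (forall i, i \in s -> G i (A i)) ->
    P (\bigcap_(i in [set` s]) A i) = (\prod_(i <- s) P (A i))%E.

Definition independent_events (d : measure_display) (T : measurableType d)
    (R : realType) (P : probability T R) (G H : set (set T)) : Prop :=
  forall A B, G A -> H B -> P (A `&` B) = (P A * P B)%E.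

Definition sigma_of (d d' : measure_display) (T : measurableType d)
    (U : measurableType d') (X : T -> U) : set (set T) :=
  preimage_set_system setT X measurable.

(* Matrices carry no measurable structure in the library; the sigma-algebra of a
   random matrix is generated by its entries, i.e. <<s coord_events X >>. *)
Definition coord_events (R : realType) (d : measure_display)
    (T : measurableType d) (m p : nat) (X : T -> 'M[R]_(m, p)) :
    set (set T) :=
  \bigcup_(ij in [set: 'I_m * 'I_p]) sigma_of (fun w => X w ij.1 ij.2).

Definition history (R : realType) (d : measure_display)
    (T : measurableType d) (m p : nat) (X : nat -> T -> 'M[R]_(m, p))
    (k : nat) : set (set T) :=
  <<s \bigcup_(l in [set l | (l <= k)%N]) coord_events (X l) >>.

(* [Y] is a version of the conditional expectation E[X | G], for a
   sub-sigma-algebra [G]. *)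
Definition is_cond_exp (d : measure_display) (T : measurableType d)
    (R : realType) (P : probability T R) (G : set (set T))
    (X Y : T -> R) : Prop :=
  [/\ P.-integrable setT (EFin \o X),
      P.-integrable setT (EFin \o Y),
      sigma_of Y `<=` G &
      forall A, G A ->
        (\int[P]_(w in A) (X w)%:E = \int[P]_(w in A) (Y w)%:E)%E].

Definition cond_exp_le (d : measure_display) (T : measurableType d)
    (R : realType) (P : probability T R) (G : set (set T))
    (X : T -> R) (c : R) : Prop :=
  exists2 Y, is_cond_exp P G X Y & {ae P, forall w, Y w <= c}.

(* Main.v *)
(* Write N^k for the gradient noise at step k and D for the projection onto
   deviations from the mean. Any stretch of the run that contains a whole period
   of mixing matrices annihilates deviations, so unrolling the recursion over at
   most two periods gives
     D x^k = - alpha sum_p w(k,p) C(k,p) (G^(p+1) - G^p),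
   with w(k,p) = k - 1 - p < 2 tau, nonexpansive C(k,p) and stochastic gradients
   G. In the second period the sum starts at the last warm-up step: consensus of
   the x^k for k <= tau forces the deviation of g^tau to be that of
   V^tau (G^tau - G^(tau-1)).

   Splitting G into gradient and noise, the noise part is of order
   alpha^2 tau^3 n sigma^2 because the noises are pairwise uncorrelated, and the
   gradient part is absorbed since 96 alpha^2 tau^4 L^2 <= 1. The descent
   inequality for f along the averages, summed over k, then gives the rate.

   Uncorrelatedness is not a consequence of unbiasedness alone: N^p need not be
   measurable for the history generated by the iterates at a later step, since
   the mixing matrices may be singular. It comes from the independence of the
   samples: the mean of N^k_i over its own sample, with all other samples frozen,
   depends only on x^k, hence vanishes almost surely by unbiasedness. *)

Require Import Defs.
From HB Require Import structures.
From mathcomp Require Import all_boot all_order all_algebra.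
From mathcomp Require Import all_classical all_reals all_analysis.
From mathcomp Require Import measurable_realfun.
From mathcomp Require Import zify ring lra.

Set Implicit Arguments.
Unset Strict Implicit.
Unset Printing Implicit Defensive.
Import Order.TTheory GRing.Theory Num.Theory.
Import numFieldNormedType.Exports.

Local Open Scope classical_set_scope.
Local Open Scope ring_scope.

(** * Euclidean norm and averaging *)

(** Three sums of weights fix the powers of [tau]. Row and column sums are at most [2 * tau ^ 2];
    their product gives the [tau ^ 4] in front of the gradient part, which the cap of order
    [1 / (tau ^ 2 * L)] on the stepsize absorbs. Sums of squares are at most [4 * tau ^ 3], and
    uncorrelated noise sees only these: hence the [tau ^ 3] in [c2]. Two obstacles shape the rest.
    Freezing all samples but one requires iterates and noises to be measurable for several
    sigma-algebras on the same space, so measurability is proved over an arbitrary domain and then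
    instantiated with coarser structures on [Om]. Since [F i] is only measurable in the sample and
    differentiable in the point, joint measurability of its gradient has to be established as well.
    Moreover, square integrability of gradients is not assumed. It is propagated along the run: the
    gap controls the gradient of the mean objective at the average, and the deviation controls its
    distance to the mean of the local gradients. *)

Definition sqnorm (R : realType) (m p : nat) (A : 'M[R]_(m, p)) : R :=
  \sum_i \sum_j A i j ^+ 2.

Definition inner (R : realType) (m p : nat) (A B : 'M[R]_(m, p)) : R :=
  \sum_i \sum_j A i j * B i j.

(** Weighted Cauchy-Schwarz, by induction on the list. The new cross term needs
    [2 * a i * S <= U * a i ^+ 2 + V]; multiplied by [U], this is nonnegativity of
    [(U * a i - S) ^+ 2] combined with [S ^+ 2 <= U * V]. For [U = 0] the induction hypothesis
    forces [S = 0]. *)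
Lemma sqr_wsum_le (R : realType) (I : Type) (r : seq I) (w a : I -> R) :
  (forall i, 0 <= w i) ->
  (\sum_(i <- r) w i * a i) ^+ 2 <=
  (\sum_(i <- r) w i) * \sum_(i <- r) w i * a i ^+ 2.
Proof.
move=> w0; elim: r => [|i r IH]; first by rewrite !big_nil expr0n mul0r.
rewrite !big_cons.
set S := \sum_(j <- r) w j * a j in IH *.
set U := \sum_(j <- r) w j in IH *.
set V := \sum_(j <- r) w j * a j ^+ 2 in IH *.
have U0 : 0 <= U by apply: sumr_ge0.
have V0 : 0 <= V by apply: sumr_ge0 => j _; rewrite mulr_ge0 ?sqr_ge0.
have [U_eq0|U_neq0] := eqVneq U 0.
  have S0 : S = 0.
    by apply/eqP; rewrite -sqrf_eq0 eq_le sqr_ge0 (le_trans IH)// U_eq0 mul0r.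
  rewrite S0 U_eq0 !addr0.
  have := w0 i; have := sqr_ge0 (a i); nra.
suff : 2 * a i * S <= U * a i ^+ 2 + V by have := w0 i; nra.
have Upos : 0 < U by rewrite lt0r U_neq0.
rewrite -(ler_pM2l Upos).
have := sqr_ge0 (U * a i - S); nra.
Qed.

Section norm_theory.
Context {R : realType}.
Implicit Types m n p : nat.

Lemma enorm_sqr m p (A : 'M[R]_(m, p)) : enorm A ^+ 2 = sqnorm A.
Proof.
rewrite sqr_sqrtr// sumr_ge0// => i _; apply: sumr_ge0 => j _.
exact: sqr_ge0.
Qed.

Lemma sqnorm_ge0 m p (A : 'M[R]_(m, p)) : 0 <= sqnorm A.
Proof. by rewrite -enorm_sqr sqr_ge0. Qed.

Lemma sqnormE m p (A : 'M[R]_(m, p)) : sqnorm A = inner A A.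
Proof. by apply: eq_bigr => i _; apply: eq_bigr => j _; rewrite expr2. Qed.

Lemma sqnorm0 m p : sqnorm (0 : 'M[R]_(m, p)) = 0.
Proof. by rewrite /sqnorm big1// => i _; rewrite big1// => j _; rewrite mxE expr0n. Qed.

Lemma sqnorm_eq0 m p (A : 'M[R]_(m, p)) : sqnorm A = 0 -> A = 0.
Proof.
move=> /eqP; rewrite psumr_eq0; last by move=> i _; apply: sumr_ge0 => j _; exact: sqr_ge0.
move=> /allP h; apply/matrixP => i j; rewrite mxE.
have := h i (mem_index_enum _) => /=; rewrite psumr_eq0; last by move=> k _; exact: sqr_ge0.
by move=> /allP /(_ j (mem_index_enum _)) /=; rewrite sqrf_eq0 => /eqP.
Qed.

Lemma innerC m p (A B : 'M[R]_(m, p)) : inner A B = inner B A.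
Proof. by apply: eq_bigr => i _; apply: eq_bigr => j _; rewrite mulrC. Qed.

Lemma innerDl m p (A B C : 'M[R]_(m, p)) : inner (A + B) C = inner A C + inner B C.
Proof.
rewrite -big_split; apply: eq_bigr => i _ /=; rewrite -big_split.
by apply: eq_bigr => j _ /=; rewrite mxE mulrDl.
Qed.

Lemma innerDr m p (A B C : 'M[R]_(m, p)) : inner A (B + C) = inner A B + inner A C.
Proof. by rewrite innerC innerDl !(innerC A). Qed.

Lemma innerZl m p c (A B : 'M[R]_(m, p)) : inner (c *: A) B = c * inner A B.
Proof.
rewrite mulr_sumr; apply: eq_bigr => i _ /=; rewrite mulr_sumr.
by apply: eq_bigr => j _ /=; rewrite mxE mulrA.
Qed.

Lemma innerZr m p c (A B : 'M[R]_(m, p)) : inner A (c *: B) = c * inner A B.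
Proof. by rewrite innerC innerZl innerC. Qed.

Lemma innerNr m p (A B : 'M[R]_(m, p)) : inner A (- B) = - inner A B.
Proof. by rewrite -scaleN1r innerZr mulN1r. Qed.

Lemma sqnormD m p (A B : 'M[R]_(m, p)) :
  sqnorm (A + B) = sqnorm A + 2 * inner A B + sqnorm B.
Proof. rewrite !sqnormE !innerDl !innerDr (innerC B A); ring. Qed.

Lemma sqnormN m p (A : 'M[R]_(m, p)) : sqnorm (- A) = sqnorm A.
Proof. by apply: eq_bigr => i _; apply: eq_bigr => j _; rewrite mxE sqrrN. Qed.

Lemma sqnormB m p (A B : 'M[R]_(m, p)) :
  sqnorm (A - B) = sqnorm A - 2 * inner A B + sqnorm B.
Proof. by rewrite sqnormD innerNr sqnormN mulrN. Qed.

Lemma sqnormZ m p c (A : 'M[R]_(m, p)) : sqnorm (c *: A) = c ^+ 2 * sqnorm A.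
Proof. by rewrite !sqnormE innerZl innerZr mulrA expr2. Qed.

Lemma sqnormD_le m p (A B : 'M[R]_(m, p)) :
  sqnorm (A + B) <= 2 * sqnorm A + 2 * sqnorm B.
Proof. by have := sqnorm_ge0 (A - B); rewrite sqnormB sqnormD; lra. Qed.

Lemma sqnormB_le m p (A B : 'M[R]_(m, p)) :
  sqnorm (A - B) <= 2 * sqnorm A + 2 * sqnorm B.
Proof. by rewrite -(sqnormN B); exact: sqnormD_le. Qed.

Lemma inner_le m p (A B : 'M[R]_(m, p)) : 2 * `|inner A B| <= sqnorm A + sqnorm B.
Proof.
have := sqnorm_ge0 (A - B); have := sqnorm_ge0 (A + B).
by rewrite sqnormB sqnormD; case: (ler0P (inner A B)) => _; lra.
Qed.

Lemma sqnorm_rows m p (A : 'M[R]_(m, p)) : sqnorm A = \sum_i sqnorm (row i A).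
Proof.
apply: eq_bigr => i _; rewrite /sqnorm big_ord1.
by apply: eq_bigr => j _; rewrite mxE.
Qed.

Lemma sqr_coord_le m p (A : 'M[R]_(m, p)) i j : A i j ^+ 2 <= sqnorm A.
Proof.
rewrite /sqnorm (bigD1 i)//= (bigD1 j)//= -addrA lerDl.
rewrite addr_ge0// sumr_ge0// => k _; first exact: sqr_ge0.
by apply: sumr_ge0 => l _; exact: sqr_ge0.
Qed.

Lemma sqnorm_wsum_le m p (I : Type) (r : seq I) (w : I -> R) (X : I -> 'M[R]_(m, p)) :
  (forall i, 0 <= w i) ->
  sqnorm (\sum_(i <- r) w i *: X i) <=
  (\sum_(i <- r) w i) * \sum_(i <- r) w i * sqnorm (X i).
Proof.
move=> w0.
have -> : \sum_(i <- r) w i * sqnorm (X i) =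
    \sum_a \sum_b \sum_(i <- r) w i * X i a b ^+ 2.
  under eq_bigr do rewrite mulr_sumr.
  rewrite exchange_big; apply: eq_bigr => a _.
  under eq_bigr do rewrite mulr_sumr.
  by rewrite exchange_big.
rewrite mulr_sumr; apply: ler_sum => a _; rewrite mulr_sumr.
apply: ler_sum => b _; rewrite summxE.
under eq_bigr do rewrite mxE.
exact: sqr_wsum_le.
Qed.

Definition nonexpansive m n (M : 'M[R]_(m, n)) : Prop :=
  forall p (X : 'M[R]_(n, p)), sqnorm (M *m X) <= sqnorm X.

Lemma nonexpansiveM m n p (A : 'M[R]_(m, n)) (B : 'M[R]_(n, p)) :
  nonexpansive A -> nonexpansive B -> nonexpansive (A *m B).
Proof. by move=> hA hB q X; rewrite -mulmxA; exact: le_trans (hA _ _) (hB _ _). Qed.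

Lemma nonexpansive1 n : nonexpansive (1%:M : 'M[R]_n).
Proof. by move=> q X; rewrite mul1mx. Qed.

(** Row sums equal to 1 give Jensen's inequality in each row; column sums equal to 1 then recover
    [sqnorm X] after summation over the rows. *)
Lemma nonexpansive_doubly_stochastic n (M : 'M[R]_n) :
  doubly_stochastic M -> nonexpansive M.
Proof.
move=> [M0 Mr Mc] p X.
apply: (@le_trans _ _ (\sum_i \sum_j \sum_k M i k * X k j ^+ 2)).
  apply: ler_sum => i _; apply: ler_sum => j _; rewrite mxE.
  by have := @sqr_wsum_le R _ (index_enum 'I_n) (M i) (X^~ j) (M0 i); rewrite Mr mul1r.
rewrite exchange_big /sqnorm [leRHS]exchange_big /=.
apply: ler_sum => j _; rewrite exchange_big /=; apply: ler_sum => k _.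
by rewrite -mulr_suml Mc mul1r.
Qed.

(** Nonexpansiveness is required for every number of columns, so it applies to the identity matrix.
    The resulting Frobenius bound is what the variance of a sum of noises sees. *)
Lemma sqnorm_nonexpansive m n (M : 'M[R]_(m, n)) : nonexpansive M -> sqnorm M <= n%:R.
Proof.
move=> /(_ _ 1%:M); rewrite mulmx1 => /le_trans; apply.
rewrite /sqnorm -[X in _ <= X%:R]card_ord -sumr_const; apply: ler_sum => i _.
rewrite (bigD1 i)//= mxE eqxx expr1n big1 ?addr0// => j jn.
by rewrite mxE eq_sym (negbTE jn) expr0n.
Qed.

Definition centering n : 'M[R]_n := 1%:M - const_mx n%:R^-1.

Lemma deviationE n d (X : 'M[R]_(n, d)) : deviation X = centering n *m X.
Proof.
rewrite /deviation /centering mulmxBl mul1mx; congr (_ - _).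
apply/matrixP => i j; rewrite !mxE big_ord1 !mxE mul1r summxE mulr_sumr.
by apply: eq_bigr => k _; rewrite !mxE.
Qed.

Lemma const_mx_doubly_stochastic n (M : 'M[R]_n) : doubly_stochastic M ->
  M *m const_mx n%:R^-1 = const_mx n%:R^-1 :> 'M[R]_n /\
  const_mx n%:R^-1 *m M = const_mx n%:R^-1 :> 'M[R]_n.
Proof.
move=> [_ Mr Mc]; split; apply/matrixP => i j; rewrite !mxE.
  under eq_bigr do rewrite mxE.
  by rewrite -mulr_suml Mr mul1r.
under eq_bigr do rewrite mxE.
by rewrite -mulr_sumr Mc mulr1.
Qed.

Lemma centering_doubly_stochastic n (M : 'M[R]_n) : doubly_stochastic M ->
  centering n *m M = M *m centering n.
Proof.
move=> /const_mx_doubly_stochastic[h1 h2].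
by rewrite /centering mulmxBl mulmxBr h1 h2 mul1mx mulmx1.
Qed.

(** Pythagoras, column by column. It gives both the nonexpansiveness of [centering] and the factor
    [n] gained by averaging. *)
Lemma sqnorm_split n d (X : 'M[R]_(n, d)) : (0 < n)%N ->
  sqnorm X = sqnorm (deviation X) + n%:R * sqnorm (avg X).
Proof.
move=> n0; have nN0 : n%:R != 0 :> R by rewrite pnatr_eq0 -lt0n.
have E i j : deviation X i j = X i j - avg X 0 j.
  by rewrite /deviation !mxE big_ord1 !mxE mul1r.
have A j : \sum_i X i j = n%:R * avg X 0 j.
  rewrite !mxE mulrA divff// mul1r summxE.
  by apply: eq_bigr => i _; rewrite mxE.
rewrite /sqnorm big_ord1 mulr_sumr exchange_big /=.
rewrite [X in _ = X + _]exchange_big -big_split /=.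
apply: eq_bigr => j _.
have -> : \sum_i deviation X i j ^+ 2 =
    \sum_i X i j ^+ 2 - 2 * avg X 0 j * \sum_i X i j + n%:R * avg X 0 j ^+ 2.
  have -> : n%:R * avg X 0 j ^+ 2 = \sum_(i < n) avg X 0 j ^+ 2.
    by rewrite sumr_const card_ord mulr_natl.
  rewrite mulr_sumr.
  rewrite -sumrB -big_split; apply: eq_bigr => i _ /=; rewrite E; ring.
rewrite A; ring.
Qed.

Lemma nonexpansive_centering n : (0 < n)%N -> nonexpansive (centering n).
Proof.
move=> n0 p X; rewrite -deviationE (sqnorm_split X n0) lerDl.
by rewrite mulr_ge0 ?sqnorm_ge0// ler0n.
Qed.

Lemma avg_doubly_stochastic n d (M : 'M[R]_n) (X : 'M[R]_(n, d)) :
  doubly_stochastic M -> avg (M *m X) = avg X.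
Proof.
move=> [_ _ Mc]; congr (_ *: _); apply/matrixP => a j; rewrite !summxE.
under eq_bigr do rewrite !mxE.
rewrite exchange_big; apply: eq_bigr => i _ /=.
by rewrite -mulr_suml Mc mul1r !mxE.
Qed.

Lemma avgD n d (X Y : 'M[R]_(n, d)) : avg (X + Y) = avg X + avg Y.
Proof.
rewrite /avg -scalerDr -big_split; congr (_ *: _).
by apply: eq_bigr => i _; rewrite linearD.
Qed.

Lemma avgZ n d c (X : 'M[R]_(n, d)) : avg (c *: X) = c *: avg X.
Proof.
rewrite /avg scalerA mulrC -scalerA [X in _ = _ *: X]scaler_sumr; congr (_ *: _).
by apply: eq_bigr => i _; rewrite linearZ.
Qed.

Lemma avgN n d (X : 'M[R]_(n, d)) : avg (- X) = - avg X.
Proof. by rewrite -scaleN1r avgZ scaleN1r. Qed.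

Lemma avgB n d (X Y : 'M[R]_(n, d)) : avg (X - Y) = avg X - avg Y.
Proof. by rewrite avgD avgN. Qed.

Lemma deviationB n d (X Y : 'M[R]_(n, d)) :
  deviation (X - Y) = deviation X - deviation Y.
Proof. by rewrite !deviationE mulmxBr. Qed.

Lemma sqnorm_avg_le n d (X : 'M[R]_(n, d)) : (0 < n)%N ->
  n%:R * sqnorm (avg X) <= sqnorm X.
Proof. by move=> n0; rewrite (sqnorm_split X n0) lerDr sqnorm_ge0. Qed.

End norm_theory.

(** * Unrolling the recursion *)

Section weights.

(* [p] contributes to the deviation at step [k] from the start of the period
   preceding that of [k] on; within the second period, from the last warm-up
   step on. *)
Definition window_start (tau k : nat) : nat :=
  if (k < tau.*2)%N then tau.-1 else ((k %/ tau).-1 * tau)%N.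

(* Truncated subtraction makes the weight vanish for [k <= p]. *)
Definition weight (tau k p : nat) : nat :=
  if (window_start tau k <= p)%N then (k - p.+1)%N else 0%N.

(** The window reaches back less than two periods from [k]. The bound depends on [k - p.+1] only, so
    it serves the sums over [p] and over [k] alike. *)
Lemma weight_le tau k p : (0 < tau)%N ->
  (weight tau k p <= if k - p.+1 < tau.*2 then k - p.+1 else 0)%N.
Proof.
move=> t0; rewrite /weight /window_start.
case: (ltnP (k - p.+1) tau.*2) => h1; first by case: ifP.
case: (ltnP k tau.*2) => h2; first by lia.
case: ifP => // h3; have := divn_eq k tau; have := ltn_pmod k t0.
have : (0 < k %/ tau)%N by rewrite divn_gt0//; lia.
by case: (k %/ tau)%N h3 => [//|q]; rewrite /= mulSn; lia.
Qed.

Lemma sum_truncated_le N M :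
  (\sum_(j < N) (if j < M then (j : nat) else 0) <= \sum_(j < M) j)%N.
Proof.
have [NM|MN] := leqP N M.
  rewrite (big_ord_widen M (fun j => if j < M then j else 0)%N NM) big_mkcond /=.
  by apply: leq_sum => i _; case: ifP => // _; rewrite ltn_ord.
rewrite (big_ord_widen N id (ltnW MN)) [leqRHS]big_mkcond /=.
exact: leq_sum.
Qed.

Lemma sum_ord_double_le tau : (\sum_(j < tau.*2) j <= 2 * tau ^ 2)%N.
Proof.
rewrite -(big_mkord xpredT id) bin2_sum bin2 -divn2 leq_divLR.
  by rewrite -!mul2n; nia.
by rewrite dvdn2 oddM; case: tau => //= m; rewrite odd_double.
Qed.

Lemma sum_weight_l tau k N : (0 < tau)%N ->
  (\sum_(p < N) weight tau k p <= 2 * tau ^ 2)%N.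
Proof.
move=> t0; apply: leq_trans (sum_ord_double_le tau).
apply: leq_trans (sum_truncated_le k tau.*2).
have [kN|Nk] := leqP k N.
  rewrite -(big_mkord xpredT (weight tau k)) (big_cat_nat (leq0n k) kN) /=.
  rewrite [X in (_ + X)%N]big_nat_cond [X in (_ + X)%N]big1 ?addn0; last first.
    move=> p /andP[/andP[kp _] _]; rewrite /weight.
    by case: ifP => // _; apply/eqP; rewrite subn_eq0 ltnW.
  rewrite big_mkord [leqRHS](reindex_inj rev_ord_inj) /=.
  by apply: leq_sum => p _; exact: weight_le.
rewrite [leqRHS](reindex_inj rev_ord_inj) /=.
rewrite (big_ord_widen k (weight tau k) (ltnW Nk)) big_mkcond.
by apply: leq_sum => p _; case: ifP => // _; exact: weight_le.
Qed.

Lemma sum_weight_r tau p N : (0 < tau)%N ->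
  (\sum_(k < N) weight tau k p <= 2 * tau ^ 2)%N.
Proof.
move=> t0; apply: leq_trans (sum_ord_double_le tau).
apply: leq_trans (sum_truncated_le N tau.*2).
pose h j := (if j < tau.*2 then j else 0)%N.
have h0 : h 0%N = 0%N by rewrite /h; case: ifP.
apply: (@leq_trans (\sum_(k < N) h (k - p.+1)%N)).
  by apply: leq_sum => k _; exact: weight_le.
rewrite -(big_mkord xpredT (fun k => h (k - p.+1)%N)) -(big_mkord xpredT h).
elim: N => [|N IH]; first by rewrite !big_geq.
have [Np|pN] := leqP N p.
  rewrite big_nat_cond big1// => k /andP[/andP[_ kN] _].
  by rewrite (_ : k - p.+1 = 0)%N//; lia.
have -> : (\sum_(0 <= k < N.+1) h (k - p.+1) = \sum_(0 <= j < N - p) h j)%N.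
  rewrite (@big_cat_nat _ _ _ p.+1) //=; last by lia.
  rewrite big_nat_cond big1 ?add0n; last first.
    by move=> k /andP[/andP[_ kN] _]; rewrite (_ : k - p.+1 = 0)%N//; lia.
  rewrite -{1}[p.+1]add0n big_addn.
  have -> : (N.+1 - p.+1 = N - p)%N by lia.
  by apply: eq_bigr => j _; rewrite addnK.
rewrite [leqRHS](@big_cat_nat _ _ _ (N - p)) //=; first exact: leq_addr.
by lia.
Qed.

(** One factor of each square is bounded by [2 * tau], the other is left to the row sum. *)
Lemma sum_sqr_weight tau k N : (0 < tau)%N ->
  (\sum_(p < N) weight tau k p ^ 2 <= 4 * tau ^ 3)%N.
Proof.
move=> t0; apply: (@leq_trans (\sum_(p < N) tau.*2 * weight tau k p)%N).
  apply: leq_sum => p _; rewrite -mulnn leq_mul2r; apply/orP; right.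
  by apply: leq_trans (weight_le _ _ t0) _; case: ifP => // /ltnW.
rewrite -big_distrr /=; apply: leq_trans (leq_mul (leqnn _) (sum_weight_l k N t0)) _.
by rewrite -mul2n !expnS expn0; lia.
Qed.

End weights.

Section unrolling.
Context {R : realType} (n d tau : nat) (W V : nat -> 'M[R]_n).
Hypotheses (n_gt0 : (0 < n)%N) (tau_gt0 : (0 < tau)%N).
Hypothesis W_consensus : finite_time_consensus tau W.
Hypothesis V_warm_up : warm_up tau V.

Fixpoint mix_prod (s m : nat) : 'M[R]_n :=
  if m is m'.+1 then W ((s + m') %% tau)%N *m mix_prod s m' else 1%:M.

Lemma doubly_stochastic_mod k : doubly_stochastic (W (k %% tau)%N).
Proof. by apply: W_consensus.1; rewrite ltn_pmod. Qed.

Lemma doubly_stochastic_warm_up k : doubly_stochastic (V k).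
Proof.
have [kt|kt] := leqP k tau; first exact: V_warm_up.1.
rewrite V_warm_up.2//; split=> [i j|i|j]; first by rewrite mxE ler0n.
  rewrite (bigD1 i)//= mxE eqxx big1 ?addr0// => j ji.
  by rewrite mxE eq_sym (negbTE ji).
rewrite (bigD1 j)//= mxE eqxx big1 ?addr0// => i ij.
by rewrite mxE (negbTE ij).
Qed.

Lemma mix_prodD s m m' : mix_prod s (m + m') = mix_prod (s + m) m' *m mix_prod s m.
Proof.
elim: m' => [|m' IH]; first by rewrite addn0 mul1mx.
by rewrite addnS /= IH mulmxA addnA.
Qed.

Lemma nonexpansive_mix_prod s m : nonexpansive (mix_prod s m).
Proof.
elim: m => [|m IH]; first exact: nonexpansive1.
apply: nonexpansiveM => //.
by apply: nonexpansive_doubly_stochastic; exact: doubly_stochastic_mod.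
Qed.

Lemma centering_mix_prod s m :
  centering n *m mix_prod s m = mix_prod s m *m centering n :> 'M[R]_n.
Proof.
elim: m => [|m IH]; first by rewrite mulmx1 mul1mx.
rewrite /= mulmxA (centering_doubly_stochastic (doubly_stochastic_mod _)).
by rewrite -!mulmxA IH.
Qed.

Lemma mix_prod_period a : mix_prod (a * tau) tau = const_mx n%:R^-1.
Proof.
rewrite -W_consensus.2.
have : forall m, (m <= tau)%N ->
    mix_prod (a * tau) m = \big[mulmx/1%:M]_(l <- rev (iota 0 m)) W l.
  elim=> [_|m IH mt]; first by rewrite /= big_nil.
  rewrite -addn1 iotaD rev_cat /= add0n big_cons -IH; last exact: ltnW.
  by rewrite addn1 /= modnMDl modn_small.
by apply.
Qed.

Lemma centering_const : centering n *m const_mx n%:R^-1 = 0 :> 'M[R]_n.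
Proof.
rewrite /centering mulmxBl mul1mx.
apply/matrixP => i j; rewrite !mxE.
under eq_bigr do rewrite !mxE.
rewrite sumr_const card_ord -[X in _ - X]mulr_natl mulrA divff ?mul1r ?subrr//.
by rewrite pnatr_eq0 -lt0n.
Qed.

(** [centering] commutes with every factor and kills the averaging matrix, so a full period may sit
    anywhere in the product. The product of [tau] consecutive matrices is known only when it starts
    at a multiple of [tau], hence the witness [a]. *)
Lemma centering_mix_prod_eq0 s m : (exists2 a, (s <= a * tau)%N & (a.+1 * tau <= s + m)%N) ->
  centering n *m mix_prod s m = 0.
Proof.
move=> [a sa asm].
have -> : m = ((a * tau - s) + (tau + (s + m - a.+1 * tau)))%N.
  by move: asm; rewrite mulSn; lia.
rewrite mix_prodD mix_prodD subnKC// mix_prod_period.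
rewrite !mulmxA centering_mix_prod -(mulmxA (mix_prod _ _)) centering_const.
by rewrite mulmx0 mul0mx.
Qed.

Variables (alpha : R) (x g e : nat -> 'M[R]_(n, d)).
Hypothesis alpha_neq0 : alpha != 0.
Hypothesis xS : forall k,
  x k.+1 = V k.+1 *m (W (k %% tau)%N *m (x k - alpha *: g k)).
Hypothesis gS : forall k, g k.+1 = V k.+1 *m (W (k %% tau)%N *m g k + e k).
Hypothesis x_consensus : forall k, (k <= tau)%N -> deviation (x k) = 0.

Lemma unroll_tracking s m : (tau <= s)%N ->
  g (s + m)%N = mix_prod s m *m g s +
    \sum_(q < m) mix_prod (s + q).+1 (m - q.+1)%N *m e (s + q)%N.
Proof.
move=> ts; elim: m => [|m IH]; first by rewrite addn0 mul1mx big_ord0 addr0.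
rewrite addnS gS V_warm_up.2 ?mul1mx; last by lia.
rewrite IH big_ord_recr /= subnn mul1mx addrA; congr (_ + _).
rewrite mulmxDr mulmxA; congr (_ + _).
rewrite mulmx_sumr; apply: eq_bigr => q _; rewrite mulmxA; congr (_ *m _).
have -> : (m.+1 - q.+1 = (m - q.+1).+1)%N by have := ltn_ord q; lia.
by rewrite /=; congr (W (_ %% _)%N *m _); have := ltn_ord q; lia.
Qed.

(** Iterates and tracking variables are mixed by the same matrices, so whatever enters reaches step
    [s + m] through the same product, at whichever update it passes from [g] to [x]. The
    coefficients count these updates: [m] for [g s], and [m - q.+1] for [e (s + q)], which first
    appears in [g (s + q).+1]. From [tau] on the warm-up matrices are the identity. *)
Lemma unroll_iterate s m : (tau <= s)%N ->
  x (s + m)%N = mix_prod s m *m x s - alpha *: (m%:R *: (mix_prod s m *m g s) +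
    \sum_(q < m) (m - q.+1)%:R *: (mix_prod (s + q).+1 (m - q.+1)%N *m e (s + q)%N)).
Proof.
move=> ts; elim: m => [|m IH].
  by rewrite addn0 mul1mx big_ord0 scale0r addr0 scaler0 subr0.
rewrite addnS xS V_warm_up.2 ?mul1mx; last by lia.
rewrite IH unroll_tracking// -addrA -opprD -scalerDr mulmxBr mulmxA; congr (_ - _).
rewrite -scalemxAr; congr (_ *: _).
rewrite addrACA -{2}[mix_prod s m *m g s]scale1r -scalerDl -[m.+1]addn1 natrD.
rewrite mulmxDr addn1 /= -scalemxAr mulmxA; congr (_ + _).
rewrite big_ord_recr /= subnn scale0r addr0 -big_split mulmx_sumr /=.
apply: eq_bigr => q _.
have mq : (m.+1 - q.+1 = (m - q.+1).+1)%N by have := ltn_ord q; lia.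
rewrite -{2}[mix_prod _ _ *m e _]scale1r -scalerDl natr1 -mq.
rewrite -scalemxAr mulmxA mq; congr (_ *: (_ *m _)).
by rewrite /=; congr (W (_ %% _)%N *m _); have := ltn_ord q; lia.
Qed.

(** The factor [V p.+1] accounts for the increment entering at the last warm-up step, [p = tau.-1];
    from [p = tau] on it is the identity. *)
Definition dev_kernel (k p : nat) : 'M[R]_n :=
  centering n *m mix_prod p.+1 (k - p.+1)%N *m V p.+1.

Lemma nonexpansive_dev_kernel k p : nonexpansive (dev_kernel k p).
Proof.
apply: nonexpansiveM; last first.
  exact/nonexpansive_doubly_stochastic/doubly_stochastic_warm_up.
by apply: nonexpansiveM; [exact: nonexpansive_centering|exact: nonexpansive_mix_prod].
Qed.

(* The deviation of the tracking variable after the first period is not assumed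
   to vanish; consensus of the iterates up to [tau] determines it. *)
Lemma centering_tracking_tau :
  centering n *m g tau = centering n *m (V tau *m e tau.-1).
Proof.
have tauE : tau = tau.-1.+1 by rewrite prednK.
have h k : (k <= tau)%N -> centering n *m x k = 0.
  by move=> kt; rewrite -deviationE x_consensus.
rewrite {1 3}tauE gS mulmxDr mulmxDr -tauE [X in X + _ = _](_ : _ = 0) ?add0r//.
have := h tau (leqnn _); rewrite {1}tauE xS -tauE.
rewrite !mulmxBr -!scalemxAr.
rewrite [X in X - _](_ : _ = 0); last first.
  rewrite mulmxA (centering_doubly_stochastic (doubly_stochastic_warm_up _)).
  rewrite -mulmxA (mulmxA (centering n)).
  rewrite (centering_doubly_stochastic (doubly_stochastic_mod _)) -mulmxA.
  by rewrite h ?mulmx0// leq_pred.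
by rewrite sub0r => /eqP; rewrite oppr_eq0 scaler_eq0 (negbTE alpha_neq0) => /eqP.
Qed.

(** Surplus weights, for [k <= p], vanish; a single upper limit [N] can therefore serve all [k <= N]
    when the deviations are summed later. *)
Lemma deviation_unroll N k : (k <= N)%N -> deviation (x k) =
  - alpha *: \sum_(p < N) (weight tau k p)%:R *: (dev_kernel k p *m e p).
Proof.
move=> kN; rewrite scaleNr.
(* Up to step [tau] both sides are zero: a window starting at [tau.-1] leaves only [p] with
   [k <= p.+1]. *)
have [kt|tk] := leqP k tau.
  rewrite x_consensus// big1 ?scaler0 ?oppr0// => p _.
  rewrite (_ : weight _ _ _ = 0%N) ?scale0r// /weight.
  have -> : window_start tau k = tau.-1 by rewrite /window_start ifT//; lia.
  by case: ifP => // h; lia.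
rewrite -(big_mkord xpredT (fun p => (weight tau k p)%:R *: (dev_kernel k p *m e p))).
rewrite (@big_cat_nat _ _ _ k)//= [X in _ *: (_ + X)]big_nat_cond.
rewrite [X in _ *: (_ + X)]big1 ?addr0; last first.
  move=> p /andP[/andP[kp _] _]; rewrite /weight.
  have -> : (k - p.+1 = 0)%N by lia.
  by case: ifP => _; rewrite scale0r.
have tail s : (window_start tau k <= s)%N -> (tau <= s)%N -> (s <= k)%N ->
    \sum_(q < k - s) (k - s - q.+1)%:R *: (centering n *m
      (mix_prod (s + q).+1 (k - s - q.+1)%N *m e (s + q)%N)) =
    \sum_(s <= p < k) (weight tau k p)%:R *: (dev_kernel k p *m e p).
  move=> ws ts sk; rewrite -[in RHS](add0n s) big_addn big_mkord; apply: eq_bigr => q _.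
  rewrite /weight ifT; last by lia.
  have -> : (k - (q + s).+1 = k - s - q.+1)%N by lia.
  rewrite /dev_kernel V_warm_up.2; last by lia.
  have -> : (k - (q + s).+1 = k - s - q.+1)%N by lia.
  by rewrite mulmx1 -mulmxA (addnC s).
have dev_x s : (tau <= s)%N -> (s <= k)%N -> deviation (x k) =
    centering n *m mix_prod s (k - s) *m x s
    - alpha *: ((k - s)%:R *: (centering n *m mix_prod s (k - s) *m g s) +
    \sum_(q < k - s) (k - s - q.+1)%:R *: (centering n *m
      (mix_prod (s + q).+1 (k - s - q.+1)%N *m e (s + q)%N))).
  move=> ts sk; rewrite deviationE -{1}(subnKC sk) unroll_iterate//.
  rewrite mulmxBr -scalemxAr mulmxDr -scalemxAr !mulmxA; congr (_ - _ *: (_ + _)).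
  by rewrite mulmx_sumr; apply: eq_bigr => q _; rewrite -scalemxAr.
(* In the second period the unrolling starts at [tau]: the deviation of [x tau] vanishes, and that
   of [g tau], with coefficient [k - tau], becomes the term [p = tau.-1]. *)
have [k2|k2] := ltnP k tau.*2.
  have wk : window_start tau k = tau.-1 by rewrite /window_start k2.
  rewrite (dev_x tau)//; last exact: ltnW.
  rewrite !centering_mix_prod -!mulmxA -deviationE x_consensus// mulmx0 sub0r.
  rewrite tail ?wk ?leq_pred//; last exact: ltnW.
  congr (- (_ *: _)).
  rewrite [RHS](@big_cat_nat _ _ _ tau)//=; last exact: ltnW.
  congr (_ + _).
  transitivity (\sum_(0 <= i < tau.-1.+1)
      (weight tau k i)%:R *: (dev_kernel k i *m e i)); last by rewrite prednK.
  rewrite big_nat_recr//=.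
  rewrite big_nat_cond big1 ?add0r; last first.
    move=> p /andP[/andP[_ pt] _]; rewrite /weight wk leqNgt pt scale0r//.
  rewrite /weight wk leqnn /dev_kernel prednK// centering_tracking_tau.
  by rewrite centering_mix_prod !mulmxA.
(* Later on, it starts at the beginning of the preceding period. The full period from [s] to
   [s + tau] ends no later than [k], so the terms in [x s] and [g s] are both annihilated. *)
set s := ((k %/ tau).-1 * tau)%N.
have wk : window_start tau k = s by rewrite /window_start ltnNge k2.
have kE := divn_eq k tau; have km := ltn_pmod k tau_gt0.
have kt2 : (2 <= k %/ tau)%N by rewrite leq_divRL// mul2n.
have s1 : (s + tau = k %/ tau * tau)%N by rewrite /s -mulSnr prednK//; lia.
have ts : (tau <= s)%N by rewrite /s -{1}[tau]mul1n leq_mul2r; lia.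
have sk : (s + tau <= k)%N by lia.
rewrite (dev_x s) ?centering_mix_prod_eq0 ?mul0mx ?sub0r//; last 2 first.
- by exists (k %/ tau).-1 => //; rewrite -/s mulSn subnKC; lia.
- by lia.
rewrite scaler0 add0r tail ?wk//; last by lia.
congr (- (_ *: _)).
rewrite [RHS](@big_cat_nat _ _ _ s)//=; last by lia.
rewrite [X in _ = X + _]big_nat_cond [X in _ = X + _]big1 ?add0r//.
by move=> p /andP[/andP[_ pt] _]; rewrite /weight wk leqNgt pt scale0r.
Qed.

End unrolling.

(** * Joint measurability of sampled gradients *)

Section caratheodory.
Context {R : realType} (d : nat).

Definition grid_round (N : nat) (x : 'rV[R]_d) : 'rV[R]_d :=
  \row_j ((Num.floor (N.+1%:R * x 0 j))%:~R / N.+1%:R).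

Lemma grid_round_cvg (x : 'rV[R]_d) : grid_round N x @[N --> \oo] --> x.
Proof.
apply/cvg_ballP => e e0; near=> N; split=> // i j; rewrite ord1 mxE.
rewrite /ball /= -[X in `|X - _|](mulfK (lt0r_neq0 (ltr0Sn R N))).
rewrite -mulrBl normrM normfV (ger0_norm (ler0n _ _)) ltr_pdivrMr ?ltr0Sn//.
rewrite mulrC; have /andP[h1 h2] := floor_itv (N.+1%:R * x 0 j).
rewrite ger0_norm ?subr_ge0// (@lt_le_trans _ _ 1)//.
  by move: h2; rewrite intrD; lra.
have : e^-1 <= N.+1%:R.
  by apply: (@le_trans _ _ N%:R); [near: N; exact: nbhs_infty_ger|rewrite ler_nat].
by rewrite -[_^-1]mul1r ler_pdivrMr// mulrC.
Unshelve. all: by end_near. Qed.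

Lemma measurable_grid_cell dB (B : measurableType dB) (u : B -> 'rV[R]_d) N
    (z : {ffun 'I_d -> int}) :
  (forall j, measurable_fun setT (fun b => u b 0 j)) ->
  measurable [set b | forall j, Num.floor (N.+1%:R * u b 0 j) = z j].
Proof.
move=> mu.
rewrite (_ : [set b | _] = \bigcap_(j in [set: 'I_d])
    ((fun b => N.+1%:R * u b 0 j) @^-1` `[(z j)%:~R, (z j + 1)%:~R[)); last first.
  apply/seteqP; split => b /= h j; first by rewrite /= in_itv/= -(h j) floor_itv.
  by apply: floor_def; have := h j I; rewrite /= in_itv.
apply: fin_bigcap_measurable => // j _.
rewrite -[X in measurable X]setTI; apply: (_ : measurable_fun setT _) => //.
exact: measurable_funM.
Qed.

(* Round [u] to a grid: the rounded function takes countably many values, and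
   continuity gives the limit. *)
Lemma measurable_caratheodory dB (B : measurableType dB) dS (S : measurableType dS)
    (u : B -> 'rV[R]_d) (F : 'rV[R]_d -> S -> R) :
  (forall j, measurable_fun setT (fun b => u b 0 j)) ->
  (forall x, measurable_fun setT (F x)) ->
  (forall s, continuous (F^~ s)) ->
  measurable_fun setT (fun p : B * S => F (u p.1) p.2).
Proof.
move=> mu mF cF.
apply: (@measurable_fun_cvg _ _ _ setT (fun N (p : B * S) => F (grid_round N (u p.1)) p.2)) => //;
  last by move=> [b s] _; exact: (cvg_comp _ _ (@grid_round_cvg (u b)) (cF s (u b))).
move=> N _ A mA; rewrite setTI.
pose grid (z : {ffun 'I_d -> int}) : 'rV[R]_d := \row_j ((z j)%:~R / N.+1%:R).
(* The grid cells are enumerated by [nat] through [pickle]; numbers that encode no cell contribute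
   the empty set. *)
pose C n : set (B * S) := if (unpickle n : option {ffun 'I_d -> int}) is Some z
  then [set b | forall j, Num.floor (N.+1%:R * u b 0 j) = z j] `*` (F (grid z) @^-1` A)
  else set0.
rewrite (_ : _ @^-1` A = \bigcup_n C n).
  apply: bigcupT_measurable => n; rewrite /C; case: (unpickle n) => // z.
  apply: measurableX; first exact: measurable_grid_cell.
  by rewrite -[X in measurable X]setTI; exact: mF.
apply/seteqP; split => [[b s]/= h|[b s] [n _]].
  pose z := [ffun j => Num.floor (N.+1%:R * u b 0 j)].
  exists (pickle z) => //; rewrite /C pickleK; split => [j|]/=; first by rewrite ffunE.
  by rewrite (_ : grid z = grid_round N (u b))//; apply/rowP => j; rewrite !mxE ffunE.
rewrite /C; case: (unpickle n) => // z [/= h1 h2].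
by rewrite (_ : grid_round N (u b) = grid z)//; apply/rowP => j; rewrite !mxE h1.
Qed.

(** The case of a one-point sample space, [unit]. *)
Lemma measurable_continuous_row dB (B : measurableType dB)
    (u : B -> 'rV[R]_d) (h : 'rV[R]_d -> R) :
  (forall j, measurable_fun setT (fun b => u b 0 j)) ->
  continuous h -> measurable_fun setT (h \o u).
Proof.
move=> mu ch.
have := @measurable_caratheodory _ B _ unit u (fun x _ => h x) mu.
move=> /(_ (fun x => measurable_cst _) (fun _ => ch)) H.
exact: (measurableT_comp H (pair2_measurable tt)).
Qed.

Lemma grad_limit (f : 'rV[R]_d -> R) x j : differentiable f x ->
  N.+1%:R * (f (x + N.+1%:R^-1 *: delta_mx 0 j) - f x) @[N --> \oo] --> grad f x 0 j.
Proof.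
move=> df; rewrite mxE.
have dv : derivable f x (delta_mx 0 j) by exact: diff_derivable.
have H : (N.+1%:R^-1 : R) @[N --> \oo] --> 0^'.
  move=> A [e /= e0 eA]; suff : \forall N \near \oo, A N.+1%:R^-1 by [].
  near=> N; apply: eA => //=.
    rewrite sub0r normrN ger0_norm//.
    by near: N; exact: near_infty_natSinv_lt (PosNum e0).
have := cvg_comp _ _ H dv.
apply: cvg_trans; apply: near_eq_cvg; near=> N.
by rewrite /= invrK (addrC x).
Unshelve. all: by end_near. Qed.

(** Partial derivatives are limits of difference quotients along the steps [N.+1%:R^-1], and each
    quotient is measurable by [measurable_caratheodory]. *)
Lemma measurable_grad dB (B : measurableType dB) dS (S : measurableType dS)
    (u : B -> 'rV[R]_d) (F : 'rV[R]_d -> S -> R) j :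
  (forall j, measurable_fun setT (fun b => u b 0 j)) ->
  (forall x, measurable_fun setT (F x)) ->
  (forall s x, differentiable (F^~ s) x) ->
  measurable_fun setT (fun p : B * S => grad (F^~ p.2) (u p.1) 0 j).
Proof.
move=> mu mF dF.
have cF s : continuous (F^~ s) by move=> x; exact: differentiable_continuous.
apply: (@measurable_fun_cvg _ _ _ setT (fun N (p : B * S) =>
  N.+1%:R * (F (u p.1 + N.+1%:R^-1 *: delta_mx 0 j) p.2 - F (u p.1) p.2))) => //;
  last by move=> [b s] _ /=; exact: grad_limit.
move=> N; apply: measurable_funM => //; apply: measurable_funB.
  apply: (@measurable_caratheodory _ _ _ _ (fun b => u b + N.+1%:R^-1 *: delta_mx 0 j)) => // i.
  under eq_fun do rewrite mxE.
  exact: measurable_funD.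
exact: (@measurable_caratheodory _ _ _ _ u F).
Qed.

End caratheodory.

(** * Independence and freezing *)

Section freezing.
Local Open Scope ereal_scope.
Context d dB dS (Om : measurableType d) (B : measurableType dB) (S : measurableType dS)
  (R : realType) (P : probability Om R) (U : {mfun Om >-> B}) (xi : {mfun Om >-> S}).
Hypothesis U_xi_independent : forall A C, measurable A -> measurable C ->
  P (U @^-1` A `&` xi @^-1` C) = P (U @^-1` A) * P (xi @^-1` C).

Let Z (w : Om) : B * S := (U w, xi w).

Let mZ : measurable_fun setT Z.
Proof. by apply/measurable_fun_pairP; split; exact: measurable_funPT. Qed.

HB.instance Definition _ := isMeasurableFun.Build _ _ _ _ Z mZ.

(** Rectangles generate the product sigma-algebra, so independence on rectangles identifies the law
    of the pair and makes Fubini available. *)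
Let joint_law X : measurable X ->
  (distribution P U \x distribution P xi) X = distribution P Z X.
Proof.
by move=> mX; apply: product_measure_unique => // A C mA mC; exact: U_xi_independent.
Qed.

Lemma integrable_freeze (phi : B * S -> \bar R) : measurable_fun setT phi ->
  P.-integrable setT (fun w => phi (U w, xi w)) ->
  (distribution P U \x distribution P xi).-integrable setT phi.
Proof.
move=> mphi iphi; apply/integrableP; split=> //.
rewrite (eq_measure_integral (distribution P Z)) => [|X mX _]; last exact: joint_law.
rewrite ge0_integral_distribution//; last exact: measurableT_comp.
by case/integrableP : iphi.
Qed.

Lemma integral_freeze (phi : B * S -> \bar R) : measurable_fun setT phi ->
  P.-integrable setT (fun w => phi (U w, xi w)) ->
  \int[P]_w phi (U w, xi w) =
  \int[distribution P U]_b \int[distribution P xi]_s phi (b, s).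
Proof.
move=> mphi iphi; rewrite -(integral_distribution (X := Z) (f := phi))//.
rewrite (integral12_prod_meas1 (integrable_freeze mphi iphi)).
by apply: eq_measure_integral => X mX _; exact/esym/joint_law.
Qed.

End freezing.

Section orthogonality.
Context d dS (Om : measurableType d) (S : measurableType dS) (R : realType)
  (P : probability Om R) (xi : {mfun Om >-> S}).

(** The identity of [Om], seen as a random element generating [<<s G>>]. Independence of a
    sigma-algebra from [xi] thus becomes independence of two random elements. *)
Definition coarsen (G : set (set Om)) (w : Om) : g_sigma_algebraType G := w.

Lemma measurable_coarsen (G : set (set Om)) : G `<=` measurable ->
  measurable_fun setT (coarsen G).
Proof.
move=> Gm _ A mA; rewrite setTI.
by apply: (smallest_sub _ Gm) mA; exact: sigma_algebra_measurable.
Qed.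

(* By Fubini, freeze the first argument of [psi] and integrate against the law of
   [xi]: the outcome is [H]-measurable, hence vanishes almost surely. *)
Lemma freeze_orthogonal (G H : set (set Om)) (psi : Om -> S -> R) (Y : Om -> R) :
  G `<=` measurable -> <<s H >> `<=` <<s G >> ->
  (forall A C, <<s G >> A -> measurable C ->
    P (A `&` xi @^-1` C) = P A * P (xi @^-1` C))%E ->
  measurable_fun setT (fun p : g_sigma_algebraType H * S => psi p.1 p.2) ->
  P.-integrable setT (EFin \o (fun w => psi w (xi w))) ->
  (forall A, <<s H >> A -> \int[P]_(w in A) (psi w (xi w))%:E = 0)%E ->
  measurable_fun setT (Y : g_sigma_algebraType G -> R) ->
  P.-integrable setT (EFin \o (fun w => Y w * psi w (xi w))) ->
  (\int[P]_w (Y w * psi w (xi w))%:E = 0)%E.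
Proof.
move=> Gm HG ind mpsi ipsi psi0 mY iYpsi.
have sGm : <<s G >> `<=` measurable.
  by apply: smallest_sub => //; exact: sigma_algebra_measurable.
have Hm : H `<=` measurable by move=> A HA; apply: sGm; apply: HG; exact: sub_sigma_algebra.
pose mG := isMeasurableFun.Build _ _ _ _ _ (measurable_coarsen Gm).
pose UG : {mfun Om >-> g_sigma_algebraType G} := HB.pack (coarsen G) mG.
pose mH := isMeasurableFun.Build _ _ _ _ _ (measurable_coarsen Hm).
pose UH : {mfun Om >-> g_sigma_algebraType H} := HB.pack (coarsen H) mH.
have indG A C : measurable A -> measurable C ->
    (P (UG @^-1` A `&` xi @^-1` C) = P (UG @^-1` A) * P (xi @^-1` C))%E.
  exact: ind.
have indH A C : measurable A -> measurable C ->
    (P (UH @^-1` A `&` xi @^-1` C) = P (UH @^-1` A) * P (xi @^-1` C))%E.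
  by move=> mA mC; apply: ind => //; exact: HG.
have mHG : measurable_fun setT (fun b : g_sigma_algebraType G => b : g_sigma_algebraType H).
  by move=> _ A mA; rewrite setTI; exact: HG.
have mpsiG : measurable_fun setT (fun p : g_sigma_algebraType G * S => psi p.1 p.2).
  apply: (measurableT_comp mpsi).
  apply/measurable_fun_pairP; split; last exact: measurable_snd.
  exact: (measurableT_comp mHG measurable_fst).
pose h (b : Om) : \bar R := (\int[distribution P xi]_s (psi b s)%:E)%E.
have EmpsiH : measurable_fun setT
  (fun p : g_sigma_algebraType H * S => (psi p.1 p.2)%:E) by exact/measurable_EFinP.
have iH := integrable_freeze indH EmpsiH ipsi.
have h_int : (distribution P UH).-integrable setT h by exact: (integrable_fubini_F iH).
have h0 : ae_eq (distribution P UH) setT h (cst 0%E).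
  apply: integral_ae_eq => // A _ mA; rewrite integral0.
  pose phi (p : g_sigma_algebraType H * S) : \bar R := (\1_A p.1 * psi p.1 p.2)%:E.
  have mphi : measurable_fun setT phi.
    apply/measurable_EFinP; apply: measurable_funM => //.
    by apply: (measurableT_comp (measurable_indic _) measurable_fst).
  have mA' : measurable (A : set Om) by apply: sGm; exact: HG mA.
  have phiE w : phi (UH w, xi w) = ((EFin \o (fun w => psi w (xi w))) \_ A) w.
    by rewrite /phi patchE /= indicE; case: ifP => _; rewrite ?mul1r ?mul0r.
  have iphi : P.-integrable setT (fun w => phi (UH w, xi w)).
    under eq_fun do rewrite phiE.
    by rewrite -integrable_mkcond//; apply: integrableS ipsi.
  have := integral_freeze indH mphi iphi.
  rewrite [X in X = _ -> _](_ : _ = 0%E) => [->|]; last first.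
    rewrite -(psi0 A mA) [RHS]integral_mkcond.
    by apply: eq_integral => w _; exact: phiE.
  rewrite [LHS]integral_mkcond; apply: eq_integral => b _.
  rewrite patchE /h /phi /= indicE; case: ifP => _.
    by under [RHS]eq_integral do rewrite mul1r.
  by under [RHS]eq_integral do rewrite mul0r; rewrite integral0.
have EmG : measurable_fun setT
    (fun p : g_sigma_algebraType G * S => (Y p.1 * psi p.1 p.2)%:E).
  apply/measurable_EFinP; apply: measurable_funM => //.
  exact: (measurableT_comp mY measurable_fst).
rewrite (integral_freeze indG EmG iYpsi).
have iGpsi := integrable_freeze indG (phi := fun p => (psi p.1 p.2)%:E)
  ((measurable_EFinP _ _).2 mpsiG) ipsi.
have ae1 := ae_integrable1 iGpsi.
(* An exceptional set measurable for [H] is measurable for [G], and both laws give it the measure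
   [P] does, as [coarsen] is the identity. *)
have hG0 : {ae distribution P UG, forall b, h b = 0%E}.
  have [N [mN N0 hN]] := h0.
  by exists N; split=> //; [exact: HG|move=> b hb; apply: hN => /= /(_ I)].
have im := integrable_fubini_F (integrable_freeze indG EmG iYpsi).
rewrite (ae_eq_integral (cst 0%E)) ?integral0//.
  exact: (measurable_int _ im).
apply: filterS2 ae1 hG0 => b ib hb _.
under eq_integral do rewrite /= EFinM.
by rewrite integralZl// -/(h b) hb mule0.
Qed.

End orthogonality.

(** * Independence of one sample from all the others *)

Section independence.
Local Open Scope ereal_scope.
Context d (Om : measurableType d) (R : realType) (P : probability Om R).

(** With [C] fixed, the two sides are finite measures in [A], namely [P] restricted to [C] and [P]
    scaled by [P C]. They agree on a generating pi-system containing the whole space, hence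
    everywhere. *)
Lemma independent_g_sigma_algebra (G : set (set Om)) (C : set Om) :
  G `<=` measurable -> setI_closed G -> G setT -> measurable C ->
  (forall A, G A -> P (A `&` C) = P A * P C) ->
  forall A, <<s G >> A -> P (A `&` C) = P A * P C.
Proof.
move=> Gm GI GT mC ind A GA.
pose r : {nonneg R} := NngNum (fine_ge0 (measure_ge0 P C)).
have rE : (r%:num%:E = P C)%E by rewrite /= fineK// fin_num_measure.
have cover : \bigcup_(_ : nat) [set: Om] = setT by rewrite bigcup_const.
have m12 B : G B -> mrestr P mC B = mscale r P B.
  by move=> GB; rewrite /mrestr /mscale rE muleC; exact: ind.
have mfin (k : nat) : mrestr P mC setT < +oo.
  rewrite /mrestr setTI; apply: (@le_lt_trans _ _ 1); first exact: probability_le1.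
  exact: ltry.
have := g_sigma_algebra_measure_unique G Gm (fun=> setT) (fun=> GT) cover
  (mrestr P mC) (mscale r P) GI m12 mfin _ GA.
by move=> E; rewrite muleC -rE; exact: E.
Qed.

Variables (K : eqType) (F0 : set (set Om)) (F : K -> set (set Om)).

(* The pi-system generating the sigma-algebra of [F0] and all [F k] with
   [k != q]. *)
Definition others_pi_system (q : K) : set (set Om) :=
  [set B | exists A0 (s : seq K) (A : K -> set Om),
    [/\ F0 A0, uniq s, q \notin s, (forall k, F k (A k)) &
        B = A0 `&` \bigcap_(k in [set` s]) A k]].

Hypotheses (F0m : F0 `<=` measurable) (Fm : forall k, F k `<=` measurable).
Hypotheses (F0T : F0 setT) (FT : forall k, F k setT).
Hypotheses (F0I : setI_closed F0) (FI : forall k, setI_closed (F k)).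
Hypothesis F_indep : mutually_independent P F.
Hypothesis F0_indep : independent_events P F0 <<s \bigcup_(k in setT) F k >>.

Lemma others_pi_system_measurable q : others_pi_system q `<=` measurable.
Proof.
move=> _ [A0 [s [A [hA0 us qs hA ->]]]].
apply: measurableI; first exact: F0m.
by apply: fin_bigcap_measurable => // k _; exact: Fm.
Qed.

Lemma others_pi_systemT q : others_pi_system q setT.
Proof.
exists setT, [::], (fun=> setT); split=> //.
by rewrite set_nil bigcap_set0 setTI.
Qed.

Lemma others_pi_system_F0 q A : F0 A -> others_pi_system q A.
Proof.
move=> hA; exists A, [::], (fun=> setT); split=> //.
by rewrite set_nil bigcap_set0 setIT.
Qed.

Lemma others_pi_system_F q k A : k != q -> F k A -> others_pi_system q A.
Proof.
move=> kq hA; exists setT, [:: k], (fun l => if l == k then A else setT); split=> //.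
- by rewrite inE eq_sym.
- by move=> l; case: eqVneq => [->|].
- rewrite setTI; apply/seteqP; split=> [w Aw l /=|w /(_ k)/=].
    by rewrite inE => ->.
  by rewrite eqxx inE eqxx; apply.
Qed.

Lemma others_pi_systemI q : setI_closed (others_pi_system q).
Proof.
move=> _ _ [A0 [s [A [hA0 us qs hA ->]]]] [B0 [t [B [hB0 ut qt hB ->]]]].
(* Over the merged index list each family is padded by [setT] outside its own list. *)
exists (A0 `&` B0), (undup (s ++ t)), (fun k =>
  (if k \in s then A k else setT) `&` (if k \in t then B k else setT)); split.
- exact: F0I.
- exact: undup_uniq.
- by rewrite mem_undup mem_cat negb_or qs.
- by move=> k; apply: FI; case: ifP.
- rewrite setIACA; congr (_ `&` _); apply/seteqP; split=> w /=.
    move=> [h1 h2] k _; split; case: ifP => // hk; [exact: h1|exact: h2].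
  move=> h; split=> k /= hk.
    by have := h k; rewrite /= mem_undup mem_cat hk => /(_ isT)[].
  by have := h k; rewrite /= mem_undup mem_cat hk orbT => /(_ isT)[].
Qed.

Lemma others_independent q A C : <<s others_pi_system q >> A -> F q C ->
  P (A `&` C) = P A * P C.
Proof.
move=> hA hC; apply: independent_g_sigma_algebra hA.
- exact: others_pi_system_measurable.
- exact: others_pi_systemI.
- exact: others_pi_systemT.
- exact: Fm hC.
move=> _ [A0 [s [B [hA0 us qs hB ->]]]].
(* As [q] is not in [s], placing [C] at index [q] makes it one more factor of the finite
   intersection, to which mutual independence applies. *)
pose B' k := if k == q then C else B k.
have hB' k : F k (B' k) by rewrite /B'; case: eqVneq => [->|].
have B'E : {in s, B' =1 B}.
  by move=> k ks; rewrite /B'; case: eqVneq => // kq; rewrite kq (negbTE qs) in ks.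
have BE : \bigcap_(k in [set` s]) B k = \bigcap_(k in [set` s]) B' k.
  by apply: eq_bigcapr => k ks; rewrite B'E.
have sig (s' : seq K) : <<s \bigcup_(k in setT) F k >> (\bigcap_(k in [set` s']) B' k).
  have mem k : <<s \bigcup_(k in setT) F k >> (B' k).
    by apply: sub_sigma_algebra; exists k.
  apply: (@fin_bigcap_measurable _ (g_sigma_algebraType (\bigcup_(k in setT) F k))).
    exact: finite_seq.
  by move=> k _; exact: mem.
have -> : A0 `&` \bigcap_(k in [set` s]) B k `&` C =
    A0 `&` \bigcap_(k in [set` q :: s]) B' k.
  rewrite -setIA BE; congr (_ `&` _); apply/seteqP; split=> w /=.
    move=> [h1 h2] k /=; rewrite inE => /orP[/eqP ->|]; last exact: h1.
    by rewrite /B' eqxx.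
  move=> h; split=> [k /= ks|]; first by apply: h; rewrite /= inE ks orbT.
  by have := h q; rewrite /= mem_head /B' eqxx => /(_ isT).
have PB' s' : uniq s' -> P (A0 `&` \bigcap_(k in [set` s']) B' k) =
    P A0 * \prod_(k <- s') P (B' k).
  by move=> us'; rewrite F0_indep ?F_indep//; exact: sig.
rewrite BE !PB'//= ?qs// big_cons {1}/B' eqxx.
by rewrite [P C * _]muleC muleA.
Qed.

End independence.

(** * Random matrices *)

Section measurable_matrix.
Context dB (B : measurableType dB) (R : realType).

Definition measurable_mx m p (X : B -> 'M[R]_(m, p)) : Prop :=
  forall i j, measurable_fun setT (fun b => X b i j).

Lemma measurable_mxM m p q (A : 'M[R]_(m, p)) (X : B -> 'M[R]_(p, q)) :
  measurable_mx X -> measurable_mx (fun b => A *m X b).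
Proof.
move=> mX i j; under eq_fun do rewrite mxE.
by apply: measurable_sum => k; apply: measurable_funM.
Qed.

Lemma measurable_mxD m p (X Y : B -> 'M[R]_(m, p)) :
  measurable_mx X -> measurable_mx Y -> measurable_mx (fun b => X b + Y b).
Proof. by move=> mX mY i j; under eq_fun do rewrite mxE; exact: measurable_funD. Qed.

Lemma measurable_mxZ m p a (X : B -> 'M[R]_(m, p)) :
  measurable_mx X -> measurable_mx (fun b => a *: X b).
Proof. by move=> mX i j; under eq_fun do rewrite mxE; exact: measurable_funM. Qed.

Lemma measurable_mxB m p (X Y : B -> 'M[R]_(m, p)) :
  measurable_mx X -> measurable_mx Y -> measurable_mx (fun b => X b - Y b).
Proof.
by move=> mX mY i j; under eq_fun do rewrite !mxE; exact: measurable_funB.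
Qed.

Lemma measurable_mx_row m p i (X : B -> 'M[R]_(m, p)) :
  measurable_mx X -> measurable_mx (fun b => row i (X b)).
Proof. by move=> mX a j; under eq_fun do rewrite mxE; exact: mX. Qed.

Lemma measurable_avg n d (X : B -> 'M[R]_(n, d)) :
  measurable_mx X -> measurable_mx (fun b => avg (X b)).
Proof.
move=> mX; apply: measurable_mxZ => i j.
under eq_fun do rewrite summxE.
by apply: measurable_sum => k; exact: measurable_mx_row.
Qed.

Lemma measurable_deviation n d (X : B -> 'M[R]_(n, d)) :
  measurable_mx X -> measurable_mx (fun b => deviation (X b)).
Proof. by move=> mX; under eq_fun do rewrite deviationE; exact: measurable_mxM. Qed.

Lemma measurable_inner m p (X Y : B -> 'M[R]_(m, p)) :
  measurable_mx X -> measurable_mx Y -> measurable_fun setT (fun b => inner (X b) (Y b)).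
Proof.
by move=> mX mY; apply: measurable_sum => i; apply: measurable_sum => j; exact: measurable_funM.
Qed.

Lemma measurable_sqnorm m p (X : B -> 'M[R]_(m, p)) :
  measurable_mx X -> measurable_fun setT (fun b => sqnorm (X b)).
Proof. by move=> mX; under eq_fun do rewrite sqnormE; exact: measurable_inner. Qed.

Lemma measurable_grad_comp d dS (S : measurableType dS) (u : B -> 'rV[R]_d) (xi : B -> S)
    (F : 'rV[R]_d -> S -> R) :
  measurable_mx u -> measurable_fun setT xi ->
  (forall x, measurable_fun setT (F x)) ->
  (forall s x, differentiable (F^~ s) x) ->
  measurable_mx (fun b => grad (F^~ (xi b)) (u b)).
Proof.
move=> mu mxi mF dF i j; rewrite ord1.
have mg := measurable_grad j (mu 0) mF dF.
have mp : measurable_fun setT (fun b : B => (b, xi b)).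
  by apply/measurable_fun_pairP; split => //; exact: measurable_id.
exact: (measurableT_comp mg mp).
Qed.

Lemma measurable_grad_const d (u : B -> 'rV[R]_d) (f : 'rV[R]_d -> R) :
  measurable_mx u -> (forall x, differentiable f x) ->
  measurable_mx (fun b => grad f (u b)).
Proof.
move=> mu df.
exact: (@measurable_grad_comp d _ unit u (fun=> tt) (fun x _ => f x)).
Qed.

End measurable_matrix.

Section gtft_measurability.
Context (R : realType) (n d tau : nat) (dS : 'I_n -> measure_display)
  (S : forall i, measurableType (dS i)) (F : forall i, 'rV[R]_d -> S i -> R).
Arguments F : clear implicits.
Hypothesis F_measurable : forall i x, measurable_fun setT (F i x).
Hypothesis F_differentiable : forall i s (x : 'rV[R]_d), differentiable (F i ^~ s) x.

Lemma measurable_stoch_grad dB (B : measurableType dB) (X : B -> 'M[R]_(n, d))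
    (s : forall i, B -> S i) :
  measurable_mx X -> (forall i, measurable_fun setT (s i)) ->
  measurable_mx (fun b => stoch_grad F (s^~ b) (X b)).
Proof.
move=> mX ms i j; under eq_fun do rewrite mxE.
exact: (measurable_grad_comp (measurable_mx_row i mX) (ms i) (@F_measurable i)
  (@F_differentiable i)).
Qed.

(** The sigma-algebra on [B] is arbitrary and only samples before step [k] are asked to be
    measurable. With a sigma-algebra that omits one sample, this says that [x k] does not depend on
    that sample. *)
Lemma measurable_gtft (W V : nat -> 'M[R]_n) (alpha : R) dB (B : measurableType dB)
    (xi : nat -> forall i, B -> S i) (x g : nat -> B -> 'M[R]_(n, d)) :
  measurable_mx (x 0%N) ->
  (forall b, gtft tau W V alpha (fun k => stoch_grad F (fun i => xi k i b))
     (x^~ b) (g^~ b)) ->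
  forall k, (forall l i, (l < k)%N -> measurable_fun setT (xi l i)) ->
  measurable_mx (x k).
Proof.
move=> mx0 xg.
have mG l : (forall i, measurable_fun setT (xi l i)) -> measurable_mx (x l) ->
    measurable_mx (fun b => stoch_grad F (fun i => xi l i b) (x l b)).
  by move=> mxi mx; exact: measurable_stoch_grad.
have xE k : x k.+1 = fun b => V k.+1 *m (W (k %% tau)%N *m (x k b - alpha *: g k b)).
  by apply/funext => b; have [_ /(_ k)[]] := xg b.
have gE k : g k.+1 = fun b => V k.+1 *m (W (k %% tau)%N *m g k b
    + stoch_grad F (fun i => xi k.+1 i b) (x k.+1 b)
    - stoch_grad F (fun i => xi k i b) (x k b)).
  by apply/funext => b; have [_ /(_ k)[]] := xg b.
have g0E : g 0%N = fun b => V 0%N *m stoch_grad F (fun i => xi 0%N i b) (x 0%N b).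
  by apply/funext => b; have [] := xg b.
(* The induction must carry [g] too, but [g k] uses the samples of step [k] itself, whence the extra
   premise in the second conjunct. *)
suff H k : (forall l i, (l < k)%N -> measurable_fun setT (xi l i)) ->
    measurable_mx (x k) /\
    ((forall i, measurable_fun setT (xi k i)) -> measurable_mx (g k)).
  by move=> k mxi; have [] := H k mxi.
elim: k => [_|k IH mxi].
  by split=> // mxi; rewrite g0E; apply: measurable_mxM; exact: mG.
have [mx mg] := IH (fun l i lk => mxi l i (ltnW lk)).
have mxik i : measurable_fun setT (xi k i) by exact: mxi.
have mxS : measurable_mx (x k.+1).
  rewrite xE; do 2!apply: measurable_mxM.
  by apply: measurable_mxB => //; apply: measurable_mxZ; exact: mg.
split=> // mxiS; rewrite gE; apply: measurable_mxM; apply: measurable_mxB; last exact: mG.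
by apply: measurable_mxD; [apply: measurable_mxM; exact: mg|exact: mG].
Qed.

End gtft_measurability.

(** * Integrable variables and square-integrable random matrices *)

Section square_integrable.
Context dOm (Om : measurableType dOm) (R : realType) (P : probability Om R).

Implicit Types X Y : Om -> R.

Definition rv_integrable (X : Om -> R) : Prop := P.-integrable setT (EFin \o X).

Lemma rv_integrable_measurable X : rv_integrable X -> measurable_fun setT X.
Proof. by move=> /(measurable_int P) /measurable_EFinP. Qed.

Lemma rv_integrableD X Y : rv_integrable X -> rv_integrable Y ->
  rv_integrable (fun w => X w + Y w).
Proof. by move=> hX hY; exact: (integrableD measurableT hX hY). Qed.

Lemma rv_integrableB X Y : rv_integrable X -> rv_integrable Y ->
  rv_integrable (fun w => X w - Y w).
Proof. by move=> hX hY; exact: (integrableB measurableT hX hY). Qed.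

Lemma rv_integrableZ a X : rv_integrable X -> rv_integrable (fun w => a * X w).
Proof. by move=> hX; exact: (integrableZl measurableT a hX). Qed.

Lemma rv_integrable_cst a : rv_integrable (fun=> a).
Proof. exact: finite_measure_integrable_cst. Qed.

Lemma rv_integrable_sum I (r : seq I) (X : I -> Om -> R) :
  (forall i, rv_integrable (X i)) -> rv_integrable (fun w => \sum_(i <- r) X i w).
Proof.
move=> hX; elim: r => [|i r IH].
  by under eq_fun do rewrite big_nil; exact: rv_integrable_cst.
by under eq_fun do rewrite big_cons; exact: rv_integrableD.
Qed.

Lemma rv_integrable_le X Y : measurable_fun setT X -> rv_integrable Y ->
  (forall w, `|X w| <= Y w) -> rv_integrable X.
Proof.
move=> mX hY XY; apply: (le_integrable measurableT _ _ hY).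
  exact/measurable_EFinP.
by move=> w _ /=; rewrite lee_fin (le_trans (XY w))// ler_norm.
Qed.

Lemma RintegralZ a X : rv_integrable X ->
  \int[P]_w (a * X w) = a * \int[P]_w X w.
Proof. exact: RintegralZl. Qed.

Lemma Rintegral_add X Y : rv_integrable X -> rv_integrable Y ->
  \int[P]_w (X w + Y w) = \int[P]_w X w + \int[P]_w Y w.
Proof. exact: RintegralD. Qed.

Lemma Rintegral_sub X Y : rv_integrable X -> rv_integrable Y ->
  \int[P]_w (X w - Y w) = \int[P]_w X w - \int[P]_w Y w.
Proof. exact: RintegralB. Qed.

Lemma Rintegral_const a : \int[P]_w (fun=> a) w = a.
Proof. by rewrite Rintegral_cst//= probability_setT mulr1. Qed.

Lemma Rintegral_sum I (r : seq I) (X : I -> Om -> R) : (forall i, rv_integrable (X i)) ->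
  \int[P]_w (\sum_(i <- r) X i w) = \sum_(i <- r) \int[P]_w X i w.
Proof.
move=> hX; elim: r => [|i r IH].
  by under eq_Rintegral do rewrite big_nil; rewrite big_nil; exact: Rintegral_const.
under eq_Rintegral do rewrite big_cons.
by rewrite big_cons Rintegral_add ?IH//; exact: rv_integrable_sum.
Qed.

Lemma Rintegral_le X Y : rv_integrable X -> rv_integrable Y ->
  (forall w, X w <= Y w) -> \int[P]_w X w <= \int[P]_w Y w.
Proof. by move=> hX hY XY; exact: le_Rintegral. Qed.

(** Replacing [X] by the minimum of [X] and [Y] changes it on a null set only and makes the
    inequality hold everywhere. *)
Lemma Rintegral_le_ae X Y : rv_integrable X -> rv_integrable Y ->
  {ae P, forall w, X w <= Y w} -> \int[P]_w X w <= \int[P]_w Y w.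
Proof.
move=> hX hY XY.
have hM : rv_integrable (fun w => Num.min (X w) (Y w)).
  apply: (@rv_integrable_le _ (fun w => `|X w| + `|Y w|)).
  - by apply: measurable_minr; exact: rv_integrable_measurable.
  - by apply: rv_integrableD; exact: integrable_norm.
  - by move=> w; rewrite minEle; case: ifP => _; rewrite ?lerDl ?lerDr.
rewrite (_ : \int[P]_w X w = \int[P]_w Num.min (X w) (Y w)).
  by apply: Rintegral_le => // w; rewrite ge_min lexx orbT.
congr fine; apply: ae_eq_integral => //.
- exact: (measurable_int P).
- exact: (measurable_int P).
- by apply: filterS XY => w h _ /=; rewrite min_l.
Qed.

Lemma Rintegral_ge0T X : (forall w, 0 <= X w) -> 0 <= \int[P]_w X w.
Proof. by move=> X0; exact: Rintegral_ge0. Qed.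

Lemma expectationE X : rv_integrable X -> ('E_P[X] = (\int[P]_w X w)%:E)%E.
Proof. by move=> hX; rewrite unlock fineK//; exact: integrable_fin_num. Qed.

Definition mx_L2 m p (X : Om -> 'M[R]_(m, p)) : Prop :=
  measurable_mx X /\ rv_integrable (fun w => sqnorm (X w)).

Lemma mx_L2_le m p q r (X : Om -> 'M[R]_(m, p)) (Y : Om -> 'M[R]_(q, r)) c :
  measurable_mx X -> mx_L2 Y -> (forall w, sqnorm (X w) <= c * sqnorm (Y w)) -> mx_L2 X.
Proof.
move=> mX [mY iY] XY; split=> //.
apply: (rv_integrable_le _ (rv_integrableZ c iY)); first exact: measurable_sqnorm.
by move=> w; rewrite ger0_norm ?sqnorm_ge0.
Qed.

Lemma mx_L2D m p (X Y : Om -> 'M[R]_(m, p)) : mx_L2 X -> mx_L2 Y ->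
  mx_L2 (fun w => X w + Y w).
Proof.
move=> [mX iX] [mY iY]; split; first exact: measurable_mxD.
apply: (rv_integrable_le _ (rv_integrableD (rv_integrableZ 2 iX) (rv_integrableZ 2 iY))).
  exact/measurable_sqnorm/measurable_mxD.
by move=> w; rewrite ger0_norm ?sqnorm_ge0// sqnormD_le.
Qed.

Lemma mx_L2Z m p a (X : Om -> 'M[R]_(m, p)) : mx_L2 X -> mx_L2 (fun w => a *: X w).
Proof.
move=> hX; apply: (mx_L2_le (c := a ^+ 2) (measurable_mxZ a hX.1) hX) => w.
by rewrite sqnormZ.
Qed.

Lemma mx_L2B m p (X Y : Om -> 'M[R]_(m, p)) : mx_L2 X -> mx_L2 Y ->
  mx_L2 (fun w => X w - Y w).
Proof.
move=> hX hY; rewrite (_ : (fun w => _) = fun w => X w + -1 *: Y w).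
  by apply: mx_L2D => //; exact: mx_L2Z.
by apply/funext => w; rewrite scaleN1r.
Qed.

Lemma mx_L2_0 m p : mx_L2 (fun=> 0 : 'M[R]_(m, p)).
Proof.
split; first by move=> i j; exact: measurable_cst.
exact: rv_integrable_cst.
Qed.

Lemma mx_L2_sum m p I (r : seq I) (X : I -> Om -> 'M[R]_(m, p)) :
  (forall i, mx_L2 (X i)) -> mx_L2 (fun w => \sum_(i <- r) X i w).
Proof.
move=> hX; elim: r => [|i r IH].
  rewrite (_ : (fun w => _) = fun=> 0); first exact: mx_L2_0.
  by apply/funext => w; rewrite big_nil.
rewrite (_ : (fun w => _) = fun w => X i w + \sum_(j <- r) X j w).
  exact: mx_L2D.
by apply/funext => w; rewrite big_cons.
Qed.

Lemma mx_L2_nonexpansive m n p (M : 'M[R]_(m, n)) (X : Om -> 'M[R]_(n, p)) :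
  nonexpansive M -> mx_L2 X -> mx_L2 (fun w => M *m X w).
Proof.
move=> hM hX; apply: (mx_L2_le (c := 1) (measurable_mxM M hX.1) hX) => w.
by rewrite mul1r.
Qed.

Lemma mx_L2_avg n d (X : Om -> 'M[R]_(n, d)) : (0 < n)%N ->
  mx_L2 X -> mx_L2 (fun w => avg (X w)).
Proof.
move=> n0 hX; apply: (mx_L2_le (c := n%:R^-1) (measurable_avg hX.1) hX) => w.
by rewrite -(ler_pM2l (x := n%:R)) ?ltr0n// mulrA divff ?pnatr_eq0 -?lt0n// mul1r sqnorm_avg_le.
Qed.

Lemma rv_integrable_inner m p (X Y : Om -> 'M[R]_(m, p)) : mx_L2 X -> mx_L2 Y ->
  rv_integrable (fun w => inner (X w) (Y w)).
Proof.
move=> [mX iX] [mY iY]; apply: (rv_integrable_le _ (rv_integrableD iX iY)).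
  exact: measurable_inner.
move=> w; have := inner_le (X w) (Y w); have := normr_ge0 (inner (X w) (Y w)); lra.
Qed.

Lemma rv_integrable_prod m p q r (X : Om -> 'M[R]_(m, p)) (Y : Om -> 'M[R]_(q, r)) i j a b :
  mx_L2 X -> mx_L2 Y -> rv_integrable (fun w => X w i j * Y w a b).
Proof.
move=> [mX iX] [mY iY]; apply: (rv_integrable_le _ (rv_integrableD iX iY)).
  exact: measurable_funM.
move=> w; have := sqr_coord_le (X w) i j; have := sqr_coord_le (Y w) a b.
rewrite normrM -(real_normK (num_real (X w i j))) -(real_normK (num_real (Y w a b))).
have := sqr_ge0 (`|X w i j| - `|Y w a b|).
have := sqr_ge0 (`|X w i j|); have := sqr_ge0 (`|Y w a b|).
by nra.
Qed.

End square_integrable.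

(** * Gradient noise *)

Section noise.
Context (R : realType) (n d tau : nat) (dS : 'I_n -> measure_display)
  (S : forall i, measurableType (dS i)) (F : forall i, 'rV[R]_d -> S i -> R)
  (f : 'I_n -> 'rV[R]_d -> R).
Arguments F : clear implicits.
Hypothesis F_measurable : forall i x, measurable_fun setT (F i x).
Hypothesis F_differentiable : forall i s (x : 'rV[R]_d), differentiable (F i ^~ s) x.
Hypothesis f_differentiable : forall i (x : 'rV[R]_d), differentiable (f i) x.
Context (W V : nat -> 'M[R]_n) (alpha sigma : R).
Context (dOm : measure_display) (Om : measurableType dOm) (P : probability Om R)
  (xi : nat -> forall i, {RV P >-> S i}) (x g : nat -> Om -> 'M[R]_(n, d)).
Arguments xi : clear implicits.
Hypothesis x0_measurable : forall i j, measurable_fun setT (fun w => x 0%N w i j).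
Hypothesis xi_independent :
  mutually_independent P (fun ki : nat * 'I_n => sigma_of (xi ki.1 ki.2)).
Hypothesis x0_xi_independent : independent_events P
  <<s coord_events (x 0%N) >>
  <<s \bigcup_(ki in [set: nat * 'I_n]) sigma_of (xi ki.1 ki.2) >>.
Hypothesis xg_gtft : forall w,
  gtft tau W V alpha (fun k => stoch_grad F (fun i => xi k i w))
    (fun k => x k w) (fun k => g k w).
Hypothesis unbiased : forall k i j,
  is_cond_exp P (history x k)
    (fun w => grad (fun y => F i y (xi k i w)) (row i (x k w)) 0 j)
    (fun w => grad (f i) (row i (x k w)) 0 j).
Hypothesis bounded_variance : forall k i,
  cond_exp_le P (history x k)
    (fun w => enorm (grad (fun y => F i y (xi k i w)) (row i (x k w))
                     - grad (f i) (row i (x k w))) ^+ 2)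
    (sigma ^+ 2).

Definition local_grad (X : 'M[R]_(n, d)) : 'M[R]_(n, d) :=
  \matrix_i grad (f i) (row i X).

Definition sampled_grad k w : 'M[R]_(n, d) :=
  stoch_grad F (fun i => xi k i w) (x k w).

Definition noise k w : 'M[R]_(n, d) := sampled_grad k w - local_grad (x k w).

Let sources (ki : nat * 'I_n) : set (set Om) := sigma_of (xi ki.1 ki.2).

Let others (q : nat * 'I_n) : set (set Om) :=
  others_pi_system <<s coord_events (x 0%N) >> sources q.

Lemma measurable_x k : measurable_mx (x k).
Proof. by apply: (measurable_gtft F_measurable F_differentiable x0_measurable xg_gtft). Qed.

Lemma sigma_of_measurable d1 (U : measurableType d1) (X : {mfun Om >-> U}) :
  sigma_of X `<=` measurable.
Proof. by move=> _ [A mA <-]; rewrite setTI; exact: measurable_funPTI. Qed.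

Lemma x0_events_measurable : <<s coord_events (x 0%N) >> `<=` measurable.
Proof.
apply: smallest_sub; first exact: sigma_algebra_measurable.
by move=> _ [ij _ [A mA <-]]; exact: x0_measurable.
Qed.

Lemma others_measurable q : others q `<=` measurable.
Proof.
apply: others_pi_system_measurable; first exact: x0_events_measurable.
by move=> k; exact: sigma_of_measurable.
Qed.

Lemma x0_eventsT : <<s coord_events (x 0%N) >> setT.
Proof. exact: (@measurableT _ (g_sigma_algebraType (coord_events (x 0%N)))). Qed.

Lemma sourcesT ki : sources ki setT.
Proof. by exists setT => //; rewrite preimage_setT setTI. Qed.

Lemma measurable_xi_others q l i : (l, i) != q ->
  measurable_fun setT (xi l i : g_sigma_algebraType (others q) -> S i).
Proof.
move=> liq _ A mA; apply: sub_sigma_algebra.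
by apply: (others_pi_system_F x0_eventsT sourcesT liq); exists A.
Qed.

Lemma measurable_x0_others q :
  measurable_mx (x 0%N : g_sigma_algebraType (others q) -> 'M[R]_(n, d)).
Proof.
move=> i j _ A mA; apply: sub_sigma_algebra; apply: others_pi_system_F0.
  exact: sourcesT.
by apply: sub_sigma_algebra; exists (i, j) => //; exists A.
Qed.

(** The iterate at step [l] uses samples of steps below [l], and the sample [q] belongs to step
    [q.1 >= l]. *)
Lemma measurable_x_others q l : (l <= q.1)%N ->
  measurable_mx (x l : g_sigma_algebraType (others q) -> 'M[R]_(n, d)).
Proof.
move=> lq; apply: (measurable_gtft F_measurable F_differentiable (@measurable_x0_others q) xg_gtft).
move=> l' i l'l; apply: measurable_xi_others; apply/eqP => E.
by move: lq; rewrite -E /= leqNgt l'l.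
Qed.

Lemma history_others q : history x q.1 `<=` <<s others q >>.
Proof.
apply: smallest_sub.
  exact: (@sigma_algebra_measurable _ (g_sigma_algebraType (others q))).
move=> _ [l /= lq [ij _ [A mA <-]]].
exact: (measurable_x_others lq).
Qed.

Lemma measurable_x_history k :
  measurable_mx (x k : g_sigma_algebraType
    (\bigcup_(l in [set l | (l <= k)%N]) coord_events (x l)) -> 'M[R]_(n, d)).
Proof.
move=> i j _ A mA; apply: sub_sigma_algebra.
by exists k => //=; exists (i, j) => //; exists A.
Qed.

Lemma noiseE k w i j : noise k w i j =
  grad (F i ^~ (xi k i w)) (row i (x k w)) 0 j - grad (f i) (row i (x k w)) 0 j.
Proof. by rewrite /noise /sampled_grad /stoch_grad /local_grad !mxE. Qed.

Lemma row_noise k w i : row i (noise k w) =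
  grad (F i ^~ (xi k i w)) (row i (x k w)) - grad (f i) (row i (x k w)).
Proof. by apply/rowP => j; rewrite [LHS]mxE noiseE [RHS]mxE [X in _ = _ + X]mxE. Qed.

Lemma rv_integrable_noise k i j : rv_integrable P (fun w => noise k w i j).
Proof.
under eq_fun do rewrite noiseE.
by have [h1 h2 _ _] := unbiased k i j; exact: rv_integrableB.
Qed.

Lemma noise_mean0 k i j A : history x k A ->
  (\int[P]_(w in A) (noise k w i j)%:E = 0)%E.
Proof.
have [h1 h2 _ h] := unbiased k i j => hA.
have mA : measurable A.
  move: A hA; apply: smallest_sub; first exact: sigma_algebra_measurable.
  by move=> _ [l _ [ij _ [B mB <-]]]; exact: measurable_x.
under eq_integral do rewrite noiseE EFinB.
rewrite integralB//; last 2 first.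
- exact: integrableS h1.
- exact: integrableS h2.
rewrite -h// subee//.
by apply: integrable_fin_num => //; exact: integrableS h1.
Qed.

(** [Y] may involve every sample except [(k, i)], in particular those of the other agents at the
    same step. *)
Lemma noise_orthogonal k i j (Y : Om -> R) :
  measurable_fun setT (Y : g_sigma_algebraType (others (k, i)) -> R) ->
  rv_integrable P (fun w => Y w * noise k w i j) ->
  \int[P]_w (Y w * noise k w i j) = 0.
Proof.
move=> mY iY; rewrite /Rintegral.
pose H := \bigcup_(l in [set l | (l <= k)%N]) coord_events (x l).
pose psi (b : Om) (s : S i) := grad (F i ^~ s) (row i (x k b)) 0 j
  - grad (f i) (row i (x k b)) 0 j.
have NE w : noise k w i j = psi w (xi k i w) by exact: noiseE.
have mxH := measurable_mx_row i (@measurable_x_history k).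
have mpsi : measurable_fun setT (fun p : g_sigma_algebraType H * S i => psi p.1 p.2).
  apply: measurable_funB.
    exact: (measurable_grad j (mxH 0) (@F_measurable i) (@F_differentiable i)).
  have m1 := measurable_grad_const mxH (f_differentiable i).
  exact: (measurableT_comp (m1 0 j) measurable_fst).
have ind A C : <<s others (k, i) >> A -> measurable C ->
    (P (A `&` xi k i @^-1` C) = P A * P (xi k i @^-1` C))%E.
  move=> hA mC; apply: (others_independent x0_events_measurable _ x0_eventsT sourcesT
    _ _ xi_independent x0_xi_independent hA).
  - by move=> q; exact: sigma_of_measurable.
  - by move=> A1 A2 h1 h2; apply: (@measurableI _ (g_sigma_algebraType (coord_events (x 0%N)))).
  - move=> q _ _ [A1 m1 <-] [A2 m2 <-]; exists (A1 `&` A2); first exact: measurableI.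
    by rewrite !setTI preimage_setI.
  - by exists C => //; rewrite setTI.
rewrite (_ : (\int[P]_w _)%E = 0%E)//.
under eq_integral do rewrite NE.
apply: (freeze_orthogonal (G := others (k, i)) (H := H)) => //.
- exact: others_measurable.
- exact: (@history_others (k, i)).
- rewrite (_ : (fun w => _) = fun w => noise k w i j); first exact: rv_integrable_noise.
  by apply/funext => w; rewrite NE.
- move=> A hA; rewrite -[RHS](noise_mean0 i j hA).
  by apply: eq_integral => w _; rewrite NE.
- rewrite (_ : (fun w => _) = fun w => Y w * noise k w i j)//.
  by apply/funext => w; rewrite NE.
Qed.

Lemma measurable_noise_others q k i j : (k, i) != q -> (k <= q.1)%N ->
  measurable_fun setT ((fun w => noise k w i j) : g_sigma_algebraType (others q) -> R).
Proof.
move=> kiq kq; rewrite (_ : (fun w => _) = fun w => grad (F i ^~ (xi k i w)) (row i (x k w)) 0 j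
  - grad (f i) (row i (x k w)) 0 j); last by apply/funext => w; exact: noiseE.
have mx := measurable_mx_row i (measurable_x_others kq).
apply: measurable_funB; last exact: (measurable_grad_const mx (f_differentiable i)).
exact: (measurable_grad_comp mx (measurable_xi_others kiq) (@F_measurable i)
  (@F_differentiable i)).
Qed.

Lemma measurable_noise k : measurable_mx (noise k).
Proof. by move=> i j; apply: rv_integrable_measurable; exact: rv_integrable_noise. Qed.

Lemma row_noise_variance k i :
  rv_integrable P (fun w => sqnorm (row i (noise k w))) /\
  \int[P]_w sqnorm (row i (noise k w)) <= sigma ^+ 2.
Proof.
have [Y [hX hY _ XY] Ys] := bounded_variance k i.
have NE : (fun w => sqnorm (row i (noise k w))) =
    (fun w => enorm (grad (fun y => F i y (xi k i w)) (row i (x k w))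
                     - grad (f i) (row i (x k w))) ^+ 2).
  by apply/funext => w; rewrite enorm_sqr row_noise.
split; first by rewrite NE.
have hT : history x k setT.
  exact: (@measurableT _ (g_sigma_algebraType
    (\bigcup_(l in [set l | (l <= k)%N]) coord_events (x l)))).
rewrite NE /Rintegral XY// -[leRHS](Rintegral_const P).
exact: (Rintegral_le_ae hY (rv_integrable_cst P _)).
Qed.

Lemma mx_L2_noise k : mx_L2 P (noise k).
Proof.
split; first exact: measurable_noise.
under eq_fun do rewrite sqnorm_rows.
by apply: rv_integrable_sum => i; have [] := row_noise_variance k i.
Qed.

(** The noise of the later step is averaged over its own sample, while the other one serves as [Y];
    at equal steps the agents differ, and either order works. *)
Lemma noise_uncorrelated p j a k i b : (p, j) != (k, i) ->
  \int[P]_w (noise p w j a * noise k w i b) = 0.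
Proof.
wlog pk : p j a k i b / (p <= k)%N => [H|] pjki.
  have [|/ltnW] := leqP p k; first by move=> pk; exact: H.
  move=> kp; under eq_Rintegral do rewrite mulrC.
  by apply: H; rewrite // eq_sym.
apply: noise_orthogonal; first exact: measurable_noise_others.
exact: (rv_integrable_prod _ _ _ _ (mx_L2_noise p) (mx_L2_noise k)).
Qed.

(** Expand the square over pairs of indices [(p, j)]; only the diagonal survives, so the squared
    coefficients add up. *)
Lemma noise_sum_variance m N (M : 'I_N -> 'M[R]_(m, n)) :
  \int[P]_w sqnorm (\sum_(p < N) M p *m noise p w) <=
  sigma ^+ 2 * \sum_(p < N) sqnorm (M p).
Proof.
pose c a (q : 'I_N * 'I_n) := M q.1 a q.2.
pose Z b (q : 'I_N * 'I_n) w := noise q.1 w q.2 b.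
have entry w a b : (\sum_(p < N) M p *m noise p w) a b = \sum_q c a q * Z b q w.
  rewrite summxE -(pair_big xpredT xpredT (fun p j => c a (p, j) * Z b (p, j) w)) /=.
  by apply: eq_bigr => p _; rewrite mxE.
have iZ b q b' q' : rv_integrable P (fun w => Z b q w * Z b' q' w).
  exact: (rv_integrable_prod _ _ _ _ (mx_L2_noise q.1) (mx_L2_noise q'.1)).
have icZ a b q q' : rv_integrable P (fun w => (c a q * c a q') * (Z b q w * Z b q' w)).
  exact/rv_integrableZ/iZ.
have E2 a b : \int[P]_w ((\sum_(p < N) M p *m noise p w) a b ^+ 2) =
    \sum_q c a q ^+ 2 * \int[P]_w (Z b q w ^+ 2).
  transitivity (\int[P]_w (\sum_q \sum_q' (c a q * c a q') * (Z b q w * Z b q' w))).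
    apply: eq_Rintegral => w _; rewrite entry expr2 mulr_suml.
    apply: eq_bigr => q _; rewrite mulr_sumr; apply: eq_bigr => q' _.
    by rewrite mulrACA.
  rewrite Rintegral_sum => [|q]; last exact: rv_integrable_sum.
  apply: eq_bigr => q _; rewrite Rintegral_sum// (bigD1 q)//= [X in _ + X]big1 ?addr0.
    rewrite RintegralZ// expr2; congr (_ * _).
  move=> q' q'q; rewrite RintegralZ// noise_uncorrelated ?mulr0//.
  by apply: contraNneq q'q; case: q q' => [q1 q2] [q1' q2'] /= [/val_inj -> ->].
have i2 a b : rv_integrable P (fun w => (\sum_(p < N) M p *m noise p w) a b ^+ 2).
  rewrite (_ : (fun w => _) =
      fun w => \sum_q \sum_q' (c a q * c a q') * (Z b q w * Z b q' w)).
    by do 2!apply: rv_integrable_sum => ?; exact: icZ.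
  apply/funext => w; rewrite entry expr2 mulr_suml.
  apply: eq_bigr => q _; rewrite mulr_sumr; apply: eq_bigr => q' _.
  by rewrite mulrACA.
rewrite Rintegral_sum => [|a]; last exact: rv_integrable_sum.
rewrite mulr_sumr.
have -> : \sum_(p < N) sigma ^+ 2 * sqnorm (M p) =
    \sum_a \sum_(q : 'I_N * 'I_n) sigma ^+ 2 * c a q ^+ 2.
  rewrite exchange_big -(pair_big xpredT xpredT
    (fun p j => \sum_a sigma ^+ 2 * c a (p, j) ^+ 2)) /=.
  apply: eq_bigr => p _; rewrite /sqnorm mulr_sumr exchange_big.
  by apply: eq_bigr => a _; rewrite mulr_sumr.
apply: ler_sum => a _; rewrite Rintegral_sum//.
under eq_bigr do rewrite E2.
(* The variance bound concerns whole rows of the noise, so the columns [b] have to be summed before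
   it can be used. *)
rewrite exchange_big; apply: ler_sum => q _ /=.
rewrite -mulr_sumr mulrC ler_wpM2r ?sqr_ge0//.
have [_] := row_noise_variance q.1 q.2; apply: le_trans.
rewrite le_eqVlt -Rintegral_sum; last first.
  by move=> b; under eq_fun do rewrite expr2; exact: iZ.
apply/orP; left; apply/eqP; apply: eq_Rintegral => w _.
by rewrite /sqnorm big_ord1; apply: eq_bigr => b _; rewrite [in RHS]mxE.
Qed.

Hypothesis n_gt0 : (0 < n)%N.

Lemma avg_mulmx (X : 'M[R]_(n, d)) : avg X = const_mx n%:R^-1 *m X.
Proof.
apply/rowP => j; rewrite /avg !mxE summxE mulr_sumr.
by apply: eq_bigr => i _; rewrite !mxE.
Qed.

Lemma avg_noise_variance k :
  \int[P]_w sqnorm (avg (noise k w)) <= sigma ^+ 2 / n%:R.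
Proof.
(* Only step [k] receives a nonzero coefficient, the averaging row, whose squared norm is
   [n * n ^ -2]. *)
pose M (p : 'I_k.+1) : 'M[R]_(1, n) := if p == ord_max then const_mx n%:R^-1 else 0.
have := noise_sum_variance M.
rewrite big_ord_recr /= big1 ?add0r /M ?eqxx; last first.
  move=> p _; rewrite ifF ?sqnorm0//; apply/negP => /eqP/(congr1 val)/= E.
  by have := ltn_ord p; rewrite E ltnn.
have -> : sqnorm (const_mx n%:R^-1 : 'M[R]_(1, n)) = n%:R^-1.
  rewrite /sqnorm big_ord1; under eq_bigr do rewrite mxE.
  rewrite sumr_const card_ord -[LHS]mulr_natl expr2 mulrA divff ?mul1r//.
  by rewrite pnatr_eq0 -lt0n.
apply: le_trans; rewrite le_eqVlt; apply/orP; left; apply/eqP.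
apply: eq_Rintegral => w _; congr sqnorm.
rewrite big_ord_recr /= big1 ?add0r ?eqxx ?avg_mulmx// => p _.
rewrite ifF ?mul0mx//; apply/negP => /eqP/(congr1 val)/= E.
by have := ltn_ord p; rewrite E ltnn.
Qed.

(** [h] has to preserve measurability for every sigma-algebra, because agent [i] calls for the one
    generated by [others (k, i)], which changes with [i]. *)
Lemma avg_noise_mean0 k (h : 'M[R]_(n, d) -> 'rV[R]_d) :
  (forall dB (B : measurableType dB) (X : B -> 'M[R]_(n, d)),
    measurable_mx X -> measurable_mx (fun b => h (X b))) ->
  mx_L2 P (fun w => h (x k w)) ->
  \int[P]_w inner (h (x k w)) (avg (noise k w)) = 0.
Proof.
move=> mh hL2.
have iy i j : rv_integrable P (fun w => h (x k w) 0 j * noise k w i j).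
  exact: (rv_integrable_prod _ _ _ _ hL2 (mx_L2_noise k)).
transitivity (\int[P]_w (\sum_j \sum_i n%:R^-1 * (h (x k w) 0 j * noise k w i j))).
  apply: eq_Rintegral => w _; rewrite /inner big_ord1; apply: eq_bigr => j _.
  rewrite avg_mulmx mxE mulr_sumr; apply: eq_bigr => i _.
  by rewrite mxE mulrCA.
rewrite Rintegral_sum => [|j]; last first.
  by apply: rv_integrable_sum => i; exact: rv_integrableZ.
rewrite big1// => j _; rewrite Rintegral_sum => [|i]; last exact: rv_integrableZ.
rewrite big1// => i _; rewrite RintegralZ// noise_orthogonal ?mulr0//.
exact: (mh _ _ _ (@measurable_x_others (k, i) k (leqnn _))).
Qed.

End noise.

(** * Smooth functions *)

Section smooth.
Context {R : realType} (d : nat).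

Lemma derive_grad (h : 'rV[R]_d -> R) x v : differentiable h x ->
  'D_v h x = inner (grad h x) v.
Proof.
move=> dh; rewrite deriveE// {1}[v]row_sum_delta linear_sum /inner big_ord1.
by apply: eq_bigr => j _; rewrite linearZ /= -deriveE// mxE mulrC.
Qed.

Lemma is_derive_line (h : 'rV[R]_d -> R) x v (t : R) :
  (forall x, differentiable h x) ->
  is_derive t 1 (fun t => h (x + t *: v)) (inner (grad h (x + t *: v)) v).
Proof.
move=> dh.
have E : (fun s : R => s^-1 *: (((fun t : R => h (x + t *: v)) \o shift t) (s *: 1)
      - h (x + t *: v))) =
    (fun s : R => s^-1 *: ((h \o shift (x + t *: v)) (s *: v) - h (x + t *: v))).
  apply/funext => s; congr (_ *: (h _ - _)).
  by rewrite /= [s *: 1]mulr1 scalerDl addrCA.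
have dv : derivable h (x + t *: v) v by exact: diff_derivable.
apply: DeriveDef; first by rewrite /derivable E.
by rewrite /derive E -derive_grad.
Qed.

Variables (h : 'rV[R]_d -> R) (L : R).
Hypothesis L_gt0 : 0 < L.
Hypothesis dh : forall x, differentiable h x.
Hypothesis lip : forall x y, sqnorm (grad h x - grad h y) <= L ^+ 2 * sqnorm (x - y).

(** The mean value theorem on [[0, 1]] replaces the usual integral along the segment: the function
    minus its quadratic model has nonpositive derivative at the intermediate point. *)
Lemma descent_lemma x v :
  h (x + v) <= h x + inner (grad h x) v + L / 2 * sqnorm v.
Proof.
pose psi t := h (x + t *: v) - (t * inner (grad h x) v + t ^+ 2 * (L / 2 * sqnorm v)).
pose dpsi t := inner (grad h (x + t *: v)) v
  - (inner (grad h x) v + 2 * t * (L / 2 * sqnorm v)).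
have dpsiP (t : R) : is_derive t 1 psi (dpsi t).
  have hq : is_derive t 1 (fun t : R => t * inner (grad h x) v + t ^+ 2 * (L / 2 * sqnorm v))
      (inner (grad h x) v + 2 * t * (L / 2 * sqnorm v)).
    by apply: is_derive_eq; rewrite !scaler0 !add0r /GRing.scale /=; ring.
  exact: (is_deriveB (is_derive_line x v t dh) hq).
have cpsi : {within `[0, 1], continuous psi}.
  apply: continuous_subspaceT => t; apply: differentiable_continuous.
  by apply/derivable1_diffP; case: (dpsiP t).
have [c /andP[c0 c1] E] := MVT ltr01 (fun t _ => dpsiP t) cpsi.
have : dpsi c <= 0.
  pose a := grad h (x + c *: v) - grad h x.
  have -> : dpsi c = inner a v - 2 * c * (L / 2 * sqnorm v).
    by rewrite /dpsi /a innerDl -[- grad h x]scaleN1r innerZl; ring.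
  have ha : sqnorm a <= (L * c) ^+ 2 * sqnorm v.
    apply: le_trans (lip _ _) _.
    by rewrite addrC addKr sqnormZ exprMn mulrA.
  have Lc : 0 < L * c by rewrite mulr_gt0.
  (* This square stands in for Cauchy-Schwarz; the division by [L * c] that follows is legitimate
     since [c] is interior. *)
  have := sqnorm_ge0 (a - (L * c) *: v); rewrite sqnormB innerZr sqnormZ => h1.
  have h2 : (L * c) * inner a v <= (L * c) * (L * c * sqnorm v) by lra.
  move: h2; rewrite (ler_pM2l Lc); lra.
move: E; rewrite subr0 mulr1 /psi scale1r scale0r addr0 expr0n /= !mul0r expr1n !mul1r.
lra.
Qed.

(** The descent lemma along the step [- L^-1 *: grad h x]. An integrable gap therefore makes the
    gradient square integrable. *)
Lemma sqnorm_grad_le m x : (forall y, m <= h y) -> sqnorm (grad h x) <= 2 * L * (h x - m).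
Proof.
move=> hm; have := descent_lemma x (- L^-1 *: grad h x).
rewrite innerZr -sqnormE sqnormZ sqrrN => H.
have := hm (x + - L^-1 *: grad h x).
set s := sqnorm _ in H *; set hy := h _ in H *.
have E : L / 2 * (L^-1 ^+ 2 * s) = L^-1 * s / 2 by field; rewrite lt0r_neq0.
rewrite E in H => h1.
have h2 : L^-1 * s <= 2 * (h x - m) by lra.
have := ler_wpM2l (ltW L_gt0) h2; rewrite mulrA divff ?lt0r_neq0// mul1r; lra.
Qed.

End smooth.

(** * Gradient of the mean objective and mean of the local gradients *)

Section mean_gradient.
Context {R : realType} (n d : nat) (f : 'I_n -> 'rV[R]_d -> R).
Hypothesis n_gt0 : (0 < n)%N.
Hypothesis f_differentiable : forall i (x : 'rV[R]_d), differentiable (f i) x.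

Let n_neq0 : n%:R != 0 :> R. Proof. by rewrite pnatr_eq0 -lt0n. Qed.

Lemma sum_funE m (h : 'I_m -> 'rV[R]_d -> R) : (fun x => \sum_i h i x) = \sum_i h i.
Proof. by apply/funext => x; elim/big_ind2 : _ => // a b a' b' -> ->. Qed.

Lemma differentiable_mean_fun x : differentiable (mean_fun f) x.
Proof.
rewrite /mean_fun; apply: differentiableM; first exact: differentiable_cst.
by rewrite sum_funE; apply: differentiable_sum => i.
Qed.

Lemma grad_mean_fun x : grad (mean_fun f) x = n%:R^-1 *: \sum_i grad (f i) x.
Proof.
apply/rowP => j; rewrite !mxE summxE.
have dv i : derivable (f i) x (delta_mx 0 j) by exact: diff_derivable.
have -> : mean_fun f = n%:R^-1 \*: (\sum_i f i).
  by apply/funext => y; rewrite /mean_fun -sum_funE.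
rewrite deriveZ; last exact: derivable_sum.
rewrite derive_sum//; congr (_ * _).
by apply: eq_bigr => i _; rewrite mxE.
Qed.

Lemma mean_gradE (X : 'M[R]_(n, d)) : mean_grad f X = avg (local_grad f X).
Proof.
rewrite /mean_grad /avg; congr (_ *: _).
by apply: eq_bigr => i _; rewrite rowK.
Qed.

Lemma avg_const_mx (u : 'rV[R]_d) : avg (const_mx 1 *m u : 'M[R]_(n, d)) = u.
Proof.
apply/rowP => j; rewrite !mxE summxE.
under eq_bigr do rewrite !mxE big_ord1 mxE mul1r.
by rewrite sumr_const card_ord -[u 0 j *+ n]mulr_natl mulrA mulVf// mul1r.
Qed.

(** At a consensus point all rows equal [u]. The Lipschitz bound on stacked local gradients thus
    yields both the smoothness of the mean objective and [mean_grad_dist]. *)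
Lemma grad_mean_funE u :
  grad (mean_fun f) u = avg (local_grad f (const_mx 1 *m u)).
Proof.
rewrite -mean_gradE grad_mean_fun /mean_grad; congr (_ *: _).
apply: eq_bigr => i _; congr (grad (f i) _).
by apply/rowP => j; rewrite !mxE big_ord1 mxE mul1r.
Qed.

Lemma sqnorm_const_mx (u : 'rV[R]_d) :
  sqnorm (const_mx 1 *m u : 'M[R]_(n, d)) = n%:R * sqnorm u.
Proof.
rewrite (sqnorm_split _ n_gt0) avg_const_mx.
by rewrite /deviation avg_const_mx subrr sqnorm0 add0r.
Qed.

Variable L : R.
Hypothesis L_gt0 : 0 < L.
Hypothesis grad_f_lipschitz : forall i x y,
  enorm (grad (f i) x - grad (f i) y) <= L * enorm (x - y).

Lemma local_grad_lipschitz (X Y : 'M[R]_(n, d)) :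
  sqnorm (local_grad f X - local_grad f Y) <= L ^+ 2 * sqnorm (X - Y).
Proof.
rewrite !sqnorm_rows mulr_sumr; apply: ler_sum => i _.
rewrite -!enorm_sqr -exprMn !linearB /= !rowK.
by rewrite ler_sqr ?nnegrE ?mulr_ge0 ?sqrtr_ge0// ltW.
Qed.

Lemma grad_mean_fun_lipschitz u v :
  sqnorm (grad (mean_fun f) u - grad (mean_fun f) v) <= L ^+ 2 * sqnorm (u - v).
Proof.
rewrite !grad_mean_funE -avgB -(ler_pM2l (x := n%:R)) ?ltr0n//.
apply: le_trans (sqnorm_avg_le _ n_gt0) _.
apply: le_trans (local_grad_lipschitz _ _) _.
by rewrite -mulmxBr sqnorm_const_mx mulrCA.
Qed.

Lemma mean_grad_dist (X : 'M[R]_(n, d)) :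
  n%:R * sqnorm (mean_grad f X - grad (mean_fun f) (avg X)) <=
  L ^+ 2 * sqnorm (deviation X).
Proof.
rewrite mean_gradE grad_mean_funE -avgB.
apply: le_trans (sqnorm_avg_le _ n_gt0) _.
exact: local_grad_lipschitz.
Qed.

End mean_gradient.

(** * Convergence rate *)

Section recursion.
Context {R : realType} (n tau : nat) (n_gt0 : (0 < n)%N) (tau_gt0 : (0 < tau)%N).
Variables (alpha sigma L : R).
Hypothesis alpha_gt0 : 0 < alpha.
Hypothesis L_gt0 : 0 < L.
Hypothesis alpha_small : 96 * (alpha ^+ 2 * L ^+ 2 * tau%:R ^+ 4) <= 1.
Variables (Edev Emg Edg : nat -> R).
Hypotheses (Edev0 : forall k, 0 <= Edev k) (Emg0 : forall k, 0 <= Emg k)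
  (Edg0 : forall k, 0 <= Edg k).
Hypothesis dev_moment : forall K k, (k <= K)%N -> Edev k <=
  4 * alpha ^+ 2 * tau%:R ^+ 2 * \sum_(p < K) (weight tau k p)%:R * Edg p
  + 32 * alpha ^+ 2 * tau%:R ^+ 3 * n%:R * sigma ^+ 2.
Hypothesis local_grad_diff_moment : forall k, Edg k <= L ^+ 2 *
  (2 * Edev k.+1 + 2 * Edev k + n%:R * alpha ^+ 2 * (Emg k + sigma ^+ 2 / n%:R)).

(** Write [Y] for the left side. The differences with [p < K] involve deviations up to [K] only, so
    the estimate closes on itself. As [96 / 8 = 12], the gradient part costs at most [12^-1] times
    [4 * Y] plus the rest. Absorbing [Y / 3] multiplies what remains by [3 / 2]: [12^-1] becomes
    [8^-1], and [32 + 12^-1] becomes [48.125], rounded up to [50]. *)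
Lemma sum_dev_moment K : \sum_(k < K.+1) Edev k <=
  8^-1 * (n%:R * alpha ^+ 2) * \sum_(k < K.+1) Emg k
  + 50 * K.+1%:R * (alpha ^+ 2 * tau%:R ^+ 3 * n%:R * sigma ^+ 2).
Proof.
set Y := \sum_(k < K.+1) Edev k; set M := \sum_(k < K.+1) Emg k.
set D := \sum_(p < K) Edg p.
have Y0 : 0 <= Y by exact: sumr_ge0.
have M0 : 0 <= M by exact: sumr_ge0.
set q := 32 * alpha ^+ 2 * tau%:R ^+ 3 * n%:R * sigma ^+ 2.
have hY : Y <= 8 * alpha ^+ 2 * tau%:R ^+ 4 * D + K.+1%:R * q.
  apply: (@le_trans _ _ (\sum_(k < K.+1) (4 * alpha ^+ 2 * tau%:R ^+ 2 *
      \sum_(p < K) (weight tau k p)%:R * Edg p + q))).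
    by apply: ler_sum => k _; apply: dev_moment; rewrite -ltnS.
  rewrite big_split /= sumr_const card_ord -[q *+ _]mulr_natl lerD2r.
  rewrite -mulr_sumr exchange_big /=.
  have -> : 8 * alpha ^+ 2 * tau%:R ^+ 4 * D =
      4 * alpha ^+ 2 * tau%:R ^+ 2 * (2 * tau%:R ^+ 2 * D) by ring.
  have c4 : 0 <= 4 * alpha ^+ 2 * tau%:R ^+ 2.
    by apply: mulr_ge0; [apply: mulr_ge0 => //|]; exact: sqr_ge0.
  rewrite (ler_wpM2l c4)// /D mulr_sumr.
  apply: ler_sum => p _; rewrite -mulr_suml ler_wpM2r//.
  by rewrite -natr_sum -natrX -natrM ler_nat sum_weight_r.
have hD : D <= L ^+ 2 * (4 * Y + n%:R * alpha ^+ 2 * (M + K.+1%:R * (sigma ^+ 2 / n%:R))).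
  have shift (E : nat -> R) : (forall p, 0 <= E p) ->
      \sum_(p < K) E p <= \sum_(p < K.+1) E p /\
      \sum_(p < K) E p.+1 <= \sum_(p < K.+1) E p.
    by move=> E0; split; [rewrite big_ord_recr|rewrite big_ord_recl] => /=; rewrite ?lerDl ?lerDr.
  apply: (@le_trans _ _ (\sum_(p < K) L ^+ 2 * (2 * Edev p.+1 + 2 * Edev p
      + n%:R * alpha ^+ 2 * (Emg p + sigma ^+ 2 / n%:R)))).
    by apply: ler_sum => p _; exact: local_grad_diff_moment.
  rewrite -mulr_sumr ler_wpM2l ?sqr_ge0// !big_split /= -!mulr_sumr big_split /=.
  rewrite sumr_const card_ord -[_ / _ *+ _]mulr_natl.
  have [h1 h2] := shift _ Edev0; have [h3 _] := shift _ Emg0.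
  have s0 : 0 <= sigma ^+ 2 / n%:R by rewrite divr_ge0 ?sqr_ge0.
  have h4 : K%:R * (sigma ^+ 2 / n%:R) <= K.+1%:R * (sigma ^+ 2 / n%:R).
    by rewrite ler_wpM2r// ler_nat.
  have c0 : 0 <= n%:R * alpha ^+ 2 by rewrite mulr_ge0 ?sqr_ge0.
  have := ler_wpM2l c0 (lerD h3 h4).
  rewrite -/Y in h1 h2; rewrite -/M; lra.
have c0 : 0 <= 8 * alpha ^+ 2 * tau%:R ^+ 4.
  apply: mulr_ge0; last exact: exprn_ge0.
  by apply: mulr_ge0 => //; exact: sqr_ge0.
have := ler_wpM2l c0 hD.
set B := 4 * Y + _ => hDB.
have B0 : 0 <= B.
  apply: addr_ge0; first exact: mulr_ge0.
  apply: mulr_ge0; first by apply: mulr_ge0 => //; exact: sqr_ge0.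
  by apply: addr_ge0 => //; apply: mulr_ge0 => //; apply: divr_ge0 => //; exact: sqr_ge0.
have hB : 8 * alpha ^+ 2 * tau%:R ^+ 4 * (L ^+ 2 * B) <= 12^-1 * B.
  have -> : 8 * alpha ^+ 2 * tau%:R ^+ 4 * (L ^+ 2 * B) =
    12^-1 * (96 * (alpha ^+ 2 * L ^+ 2 * tau%:R ^+ 4)) * B by field.
  rewrite ler_wpM2r// -[leRHS]mulr1 ler_wpM2l//.
have nE : n%:R * alpha ^+ 2 * (K.+1%:R * (sigma ^+ 2 / n%:R)) = K.+1%:R * (alpha ^+ 2 * sigma ^+ 2).
  by field; rewrite pnatr_eq0 -lt0n.
have tau1 : 1 <= tau%:R ^+ 3 * n%:R :> R.
  by rewrite -natrX -natrM ler1n muln_gt0 expn_gt0 tau_gt0.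
have h5 : K.+1%:R * (alpha ^+ 2 * sigma ^+ 2) <=
    K.+1%:R * (alpha ^+ 2 * tau%:R ^+ 3 * n%:R * sigma ^+ 2).
  rewrite ler_wpM2l// -[_ * _ * n%:R]mulrA -mulrA ler_wpM2l ?sqr_ge0//.
  by rewrite -{1}[sigma ^+ 2]mul1r ler_wpM2r ?sqr_ge0.
have q1 : K.+1%:R * q = 32 * (K.+1%:R * (alpha ^+ 2 * tau%:R ^+ 3 * n%:R * sigma ^+ 2)).
  by rewrite /q; ring.
have X2_ge0 : 0 <= K.+1%:R * (alpha ^+ 2 * tau%:R ^+ 3 * n%:R * sigma ^+ 2).
  apply: mulr_ge0 => //; apply: mulr_ge0; last exact: sqr_ge0.
  apply: mulr_ge0 => //; apply: mulr_ge0; first exact: sqr_ge0.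
  exact: exprn_ge0.
have BE : B = 4 * Y + (n%:R * alpha ^+ 2 * M + K.+1%:R * (alpha ^+ 2 * sigma ^+ 2)).
  by rewrite /B [_ * (M + _)]mulrDr nE.
have := le_trans hDB hB; rewrite BE; move: hY h5; rewrite q1.
rewrite -[50 * K.+1%:R * _]mulrA -[8^-1 * _ * M]mulrA.
set X1 := K.+1%:R * (alpha ^+ 2 * sigma ^+ 2).
set X2 := K.+1%:R * (_ * sigma ^+ 2) in X2_ge0 *.
set X3 := n%:R * alpha ^+ 2 * M.
set X4 := _ * D; lra.
Qed.

Variables (Efg Egap : nat -> R).
Hypothesis Efg0 : forall k, 0 <= Efg k.
Hypothesis Egap0 : forall k, 0 <= Egap k.
Hypothesis expected_descent : forall k, Egap k.+1 <= Egap k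
  - alpha / 2 * (Efg k + Emg k - L ^+ 2 / n%:R * Edev k)
  + L / 2 * (alpha ^+ 2 * (Emg k + sigma ^+ 2 / n%:R)).

Lemma sum_descent K : alpha / 2 * \sum_(k < K) (Emg k + Efg k) <= Egap 0%N
  + alpha / 2 * (L ^+ 2 / n%:R) * \sum_(k < K) Edev k
  + L / 2 * alpha ^+ 2 * \sum_(k < K) Emg k
  + K%:R * (L / 2 * alpha ^+ 2 * (sigma ^+ 2 / n%:R)).
Proof.
(* The final gap is kept on the left so that the induction goes through; being nonnegative, it is
   dropped here. *)
suff : Egap K + alpha / 2 * \sum_(k < K) (Emg k + Efg k) <= Egap 0%N
  + alpha / 2 * (L ^+ 2 / n%:R) * \sum_(k < K) Edev k
  + L / 2 * alpha ^+ 2 * \sum_(k < K) Emg k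
  + K%:R * (L / 2 * alpha ^+ 2 * (sigma ^+ 2 / n%:R)).
  by apply: le_trans; rewrite lerDr.
elim: K => [|K IH]; first by rewrite !big_ord0 !mulr0 mul0r !addr0.
rewrite !big_ord_recr /= -[K.+1%:R]natr1.
move: IH (expected_descent K).
set S1 := \sum_(k < K) _; set S2 := \sum_(k < K) _; set S3 := \sum_(k < K) _.
set a := alpha / 2; set b := L ^+ 2 / n%:R; set c := L / 2; set e := sigma ^+ 2 / n%:R.
move=> IH H; rewrite -subr_ge0; move: IH H; rewrite -subr_ge0 -[_ <= Egap K - _ + _]subr_ge0.
move=> IH H; have := addr_ge0 IH H; congr (0 <= _); ring.
Qed.

(** The smallness condition gives [alpha * L <= 8^-1], so the deviation term and the second-order
    term each cost at most [alpha / 16] times the sum of [Emg]; [alpha / 2 - alpha / 8] still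
    exceeds [alpha / 4]. The constant [25] is half of [50]. *)
Lemma sum_grad_bound K : alpha / 4 * \sum_(k < K.+1) (Emg k + Efg k) <= Egap 0%N
  + K.+1%:R * (25 * (alpha ^+ 3 * (tau%:R ^+ 3 * L ^+ 2 * sigma ^+ 2))
    + alpha ^+ 2 * (L * sigma ^+ 2 / n%:R) / 2).
Proof.
have h1 := sum_descent K.+1; have h2 := sum_dev_moment K.
set M := \sum_(k < K.+1) Emg k in h1 h2 *; set Y := \sum_(k < K.+1) Edev k in h1 h2 *.
set Z := \sum_(k < K.+1) _ in h1 *.
have n0 : 0 < n%:R :> R by rewrite ltr0n.
have M0 : 0 <= M by exact: sumr_ge0.
have MZ : M <= Z by apply: ler_sum => k _; rewrite lerDl.
have tau1 : 1 <= tau%:R ^+ 4 :> R by rewrite -natrX ler1n expn_gt0 tau_gt0.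
have aL : 96 * (alpha * L) ^+ 2 <= 1.
  apply: le_trans alpha_small; rewrite exprMn ler_wpM2l// -[leLHS]mulr1.
  by rewrite ler_wpM2l// mulr_ge0 ?sqr_ge0.
have aL8 : alpha * L <= 8^-1.
  rewrite -(@ler_pXn2r _ 2) ?nnegrE// ?mulr_ge0 ?ltW//; lra.
have a0 : 0 <= alpha / 2 * (L ^+ 2 / n%:R).
  by apply: mulr_ge0; apply: divr_ge0 => //; rewrite ?sqr_ge0// ltW.
have h3 := ler_wpM2l a0 h2.
have E3 : alpha / 2 * (L ^+ 2 / n%:R) * (8^-1 * (n%:R * alpha ^+ 2) * M
   + 50 * K.+1%:R * (alpha ^+ 2 * tau%:R ^+ 3 * n%:R * sigma ^+ 2)) =
   alpha / 16 * ((alpha * L) ^+ 2 * M)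
   + K.+1%:R * (25 * (alpha ^+ 3 * (tau%:R ^+ 3 * L ^+ 2 * sigma ^+ 2))).
  by field; rewrite lt0r_neq0.
rewrite E3 in h3.
have h4 : (alpha * L) ^+ 2 * M <= M by rewrite -[leRHS]mul1r ler_wpM2r//; lra.
have h5 : alpha / 16 * ((alpha * L) ^+ 2 * M) <= alpha / 16 * M.
  by rewrite ler_wpM2l// divr_ge0// ltW.
have h6 : L / 2 * alpha ^+ 2 * M <= alpha / 16 * M.
  rewrite ler_wpM2r// (_ : L / 2 * alpha ^+ 2 = alpha / 2 * (alpha * L)); last by field.
  rewrite (_ : alpha / 16 = alpha / 2 * 8^-1); last by field.
  by rewrite ler_wpM2l// divr_ge0// ltW.
have h7 : alpha / 8 * M <= alpha / 8 * Z by rewrite ler_wpM2l// divr_ge0// ltW.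
have Z0 : 0 <= alpha * Z by apply: mulr_ge0; [exact: ltW|exact: le_trans MZ].
have E4 : K.+1%:R * (L / 2 * alpha ^+ 2 * (sigma ^+ 2 / n%:R)) =
  K.+1%:R * (alpha ^+ 2 * (L * sigma ^+ 2 / n%:R) / 2) by field; rewrite lt0r_neq0.
rewrite E4 in h1; rewrite mulrDr.
move: h1 h3; set A1 := K.+1%:R * _; set A2 := K.+1%:R * _.
set A3 := alpha / 2 * (L ^+ 2 / n%:R) * Y.
move: h5 h6; set A4 := alpha / 16 * (_ * M); set A5 := L / 2 * _ * M.
lra.
Qed.

End recursion.

(** * Choice of the stepsize and resulting rate *)

Section stepsize.
Context {R : realType}.

Lemma powR_half_sqr (a : R) : 0 <= a -> (a `^ 2^-1) ^+ 2 = a.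
Proof.
by move=> a0; rewrite -powR_mulrn ?powR_ge0// -powRrM mulVf ?powRr1// pnatr_eq0.
Qed.

Lemma powR_third_cube (a : R) : 0 <= a -> (a `^ 3^-1) ^+ 3 = a.
Proof.
by move=> a0; rewrite -powR_mulrn ?powR_ge0// -powRrM mulVf ?powRr1// pnatr_eq0.
Qed.

Lemma powR_two_thirds_cube (a : R) : 0 <= a -> (a `^ (2 / 3)) ^+ 3 = a ^+ 2.
Proof.
move=> a0; rewrite -powR_mulrn ?powR_ge0// -powRrM -powR_mulrn//.
by rewrite divfK// pnatr_eq0.
Qed.

(** Identities between fractional powers are proved by squaring or cubing both sides, which leaves
    field identities. *)
Lemma expr_injective_pos k (a b : R) : (0 < k)%N -> 0 <= a -> 0 <= b ->
  a ^+ k = b ^+ k -> a = b.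
Proof. by move=> k0 a0 b0 /eqP; rewrite eqrXn2// => /eqP. Qed.

Variables (n tau T : nat) (n_gt0 : (0 < n)%N) (tau_gt0 : (0 < tau)%N) (T_gt0 : (0 < T)%N).
Variables (L sigma : R) (L_gt0 : 0 < L) (sigma_gt0 : 0 < sigma).

Let c1 := L * sigma ^+ 2 / n%:R.
Let c2 := tau%:R ^+ 3 * L ^+ 2 * sigma ^+ 2.
Let a1 := (c1 * T%:R)^-1 `^ 2^-1.
Let a2 := (c2 * T%:R)^-1 `^ 3^-1.
Let a3 := (4 * Num.sqrt 6 * tau%:R ^+ 2 * L)^-1.

Definition stepsize : R := Num.min a1 (Num.min a2 a3).

Let s := (L * sigma ^+ 2 / (n%:R * T%:R)) `^ 2^-1.
Let u := (L * sigma / T%:R) `^ (2 / 3).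

Let n0 : 0 < n%:R :> R. Proof. by rewrite ltr0n. Qed.
Let t0 : 0 < tau%:R :> R. Proof. by rewrite ltr0n. Qed.
Let T0 : 0 < T%:R :> R. Proof. by rewrite ltr0n. Qed.
Let c1_gt0 : 0 < c1. Proof. by rewrite divr_gt0// mulr_gt0// exprn_gt0. Qed.
Let c2_gt0 : 0 < c2. Proof. by rewrite !mulr_gt0// exprn_gt0. Qed.
Let a1_gt0 : 0 < a1. Proof. by rewrite powR_gt0// invr_gt0 mulr_gt0. Qed.
Let a2_gt0 : 0 < a2. Proof. by rewrite powR_gt0// invr_gt0 mulr_gt0. Qed.
Let a3_gt0 : 0 < a3.
Proof. by rewrite invr_gt0 !mulr_gt0// ?sqrtr_gt0// exprn_gt0. Qed.
Let s_ge0 : 0 <= s. Proof. exact: powR_ge0. Qed.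
Let u_ge0 : 0 <= u. Proof. exact: powR_ge0. Qed.

Let a1E : a1 ^+ 2 = (c1 * T%:R)^-1.
Proof. by rewrite powR_half_sqr// invr_ge0 mulr_ge0// ltW. Qed.
Let a2E : a2 ^+ 3 = (c2 * T%:R)^-1.
Proof. by rewrite powR_third_cube// invr_ge0 mulr_ge0// ltW. Qed.
Let sE : s ^+ 2 = c1 / T%:R.
Proof.
rewrite powR_half_sqr.
  by rewrite /c1; field; rewrite !lt0r_neq0.
by rewrite divr_ge0// mulr_ge0 ?sqr_ge0// ltW.
Qed.
Let uE : u ^+ 3 = (L * sigma / T%:R) ^+ 2.
Proof. by rewrite powR_two_thirds_cube// divr_ge0// mulr_ge0// ltW. Qed.

Lemma stepsize_gt0 : 0 < stepsize.
Proof. by rewrite !lt_min a1_gt0 a2_gt0. Qed.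

(* [96] is the square of [4 * sqrt 6]. *)
Lemma stepsize_small : 96 * (stepsize ^+ 2 * L ^+ 2 * tau%:R ^+ 4) <= 1.
Proof.
have h : stepsize * (4 * Num.sqrt 6 * tau%:R ^+ 2 * L) <= 1.
  rewrite -ler_pdivlMr ?mul1r; first by rewrite !ge_min lexx !orbT.
  by move: a3_gt0; rewrite invr_gt0.
have h0 : 0 <= stepsize * (4 * Num.sqrt 6 * tau%:R ^+ 2 * L).
  apply: mulr_ge0; first exact/ltW/stepsize_gt0.
  by apply/ltW; move: a3_gt0; rewrite invr_gt0.
rewrite (_ : 96 * _ = (stepsize * (4 * Num.sqrt 6 * tau%:R ^+ 2 * L)) ^+ 2).
  by rewrite expr_le1.
have h6 : Num.sqrt 6 ^+ 2 = 6 :> R by rewrite sqr_sqrtr.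
rewrite !exprMn h6; ring.
Qed.

(** The inverse of a minimum is one of the three inverses, hence at most their sum. *)
Lemma inv_stepsize_le : (stepsize * T%:R)^-1 <=
  s + tau%:R * u + 4 * Num.sqrt 6 * (tau%:R ^+ 2 * L / T%:R).
Proof.
have e1 : (a1 * T%:R)^-1 = s.
  apply: (@expr_injective_pos 2) => //; first by rewrite invr_ge0 mulr_ge0// ltW.
  rewrite sE exprVn exprMn a1E; field.
  by rewrite !lt0r_neq0.
have e2 : (a2 * T%:R)^-1 = tau%:R * u.
  apply: (@expr_injective_pos 3) => //; first by rewrite invr_ge0 mulr_ge0// ltW.
    by rewrite mulr_ge0// ltW.
  rewrite exprVn !exprMn a2E uE /c2; field.
  by rewrite !lt0r_neq0.
have e3 : (a3 * T%:R)^-1 = 4 * Num.sqrt 6 * (tau%:R ^+ 2 * L / T%:R).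
  rewrite /a3 invfM invrK; ring.
have p2 : 0 <= tau%:R * u by rewrite mulr_ge0// ltW.
have p3 : 0 <= 4 * Num.sqrt 6 * (tau%:R ^+ 2 * L / T%:R).
  by rewrite -e3 invr_ge0 mulr_ge0// ltW.
have : stepsize = a1 \/ stepsize = a2 \/ stepsize = a3.
  rewrite /stepsize; case: (leP a1) => _; first by left.
  by right; case: (leP a2) => _; [left|right].
case=> [->|[->|->]]; rewrite ?e1 ?e2 ?e3.
- by rewrite -addrA lerDl addr_ge0.
- by rewrite -addrA addrCA lerDl addr_ge0.
- by rewrite lerDr addr_ge0.
Qed.

(** Where the stepsize enters with a positive power, it is bounded by the entry of the minimum that
    balances the term: [a1 * c1 = s] here, and [a2 ^+ 2 * c2 = tau%:R * u] for the other noise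
    term. *)
Lemma stepsize_c1 : stepsize * c1 <= s.
Proof.
rewrite (_ : s = a1 * c1); first by rewrite (ler_wpM2r (ltW c1_gt0))// ge_min lexx.
apply: (@expr_injective_pos 2) => //; first by rewrite mulr_ge0// ltW.
rewrite sE exprMn a1E; field.
by rewrite !lt0r_neq0.
Qed.

Lemma stepsize_c2 : stepsize ^+ 2 * c2 <= tau%:R * u.
Proof.
rewrite (_ : tau%:R * u = a2 ^+ 2 * c2).
  rewrite (ler_wpM2r (ltW c2_gt0))// ler_pXn2r ?nnegrE ?(ltW stepsize_gt0) ?(ltW a2_gt0)//.
  by rewrite !ge_min lexx orbT.
apply: (@expr_injective_pos 3) => //; first by rewrite mulr_ge0// ltW.
  by rewrite mulr_ge0 ?sqr_ge0// ltW.
rewrite !exprMn uE a2E /c2; field.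
by rewrite !lt0r_neq0.
Qed.

(** After division by [stepsize / 4 * T.+1%:R] the gap brings [4 * Delta] times each term of
    [inv_stepsize_le], the noise terms bring [100 = 4 * 25] and [2 = 4 / 2]. *)
Lemma rate_bound (S gap0 Delta : R) : `|gap0| <= Delta ->
  stepsize / 4 * S <= gap0 + T.+1%:R *
    (25 * (stepsize ^+ 3 * c2) + stepsize ^+ 2 * c1 / 2) ->
  T.+1%:R^-1 * S <= 16 * Num.sqrt 6 * Delta * tau%:R ^+ 2 * L / T%:R
    + (4 * Delta + 100) * tau%:R * u + (4 * Delta + 2) * s.
Proof.
move=> hD H; have st0 := stepsize_gt0.
have T1 : 0 < T.+1%:R :> R by rewrite ltr0n.
have D0 : 0 <= Delta by exact: le_trans hD.
have h1 : T.+1%:R^-1 * S <= 4 * gap0 / (stepsize * T.+1%:R)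
    + 100 * (stepsize ^+ 2 * c2) + 2 * (stepsize * c1).
  have p : 0 <= 4 / (stepsize * T.+1%:R) by rewrite divr_ge0// mulr_ge0// ltW.
  have := ler_wpM2l p H.
  have -> : 4 / (stepsize * T.+1%:R) * (stepsize / 4 * S) = T.+1%:R^-1 * S.
    by field; rewrite !lt0r_neq0.
  move=> /le_trans; apply; rewrite le_eqVlt; apply/orP; left; apply/eqP.
  by field; rewrite !lt0r_neq0.
have h2 : 4 * gap0 / (stepsize * T.+1%:R) <= 4 * Delta * (stepsize * T%:R)^-1.
  apply: (@le_trans _ _ (4 * Delta / (stepsize * T.+1%:R))).
    have p : 0 <= (stepsize * T.+1%:R)^-1 by rewrite invr_ge0 mulr_ge0// ltW.
    rewrite (ler_wpM2r p)// ler_wpM2l//.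
    exact: le_trans (ler_norm _) hD.
  rewrite ler_wpM2l ?mulr_ge0// lef_pV2 ?posrE ?mulr_gt0//.
  by rewrite (ler_wpM2l (ltW st0))// ler_nat.
have h3 : 4 * Delta * (stepsize * T%:R)^-1 <= 4 * Delta *
    (s + tau%:R * u + 4 * Num.sqrt 6 * (tau%:R ^+ 2 * L / T%:R)).
  by rewrite ler_wpM2l ?mulr_ge0// inv_stepsize_le.
have h4 := stepsize_c1; have h5 := stepsize_c2.
apply: le_trans h1 _; apply: (@le_trans _ _ (4 * Delta *
    (s + tau%:R * u + 4 * Num.sqrt 6 * (tau%:R ^+ 2 * L / T%:R))
    + 100 * (tau%:R * u) + 2 * s)).
  apply: lerD; last by rewrite ler_wpM2l.
  by apply: lerD; [exact: le_trans h2 h3|rewrite ler_wpM2l].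
by rewrite le_eqVlt; apply/orP; left; apply/eqP; ring.
Qed.

End stepsize.

(** * Moment estimates along the run *)

Section convergence.
Context (R : realType) (n d tau : nat) (f : 'I_n -> 'rV[R]_d -> R).
Hypotheses (n_gt0 : (0 < n)%N) (tau_gt0 : (0 < tau)%N).
Hypothesis f_differentiable : forall i (x : 'rV[R]_d), differentiable (f i) x.
Context (L : R).
Hypothesis L_gt0 : 0 < L.
Hypothesis grad_f_lipschitz : forall i x y,
  enorm (grad (f i) x - grad (f i) y) <= L * enorm (x - y).
Context (fmin : R).
Hypothesis fmin_le : forall x, fmin <= mean_fun f x.
Context (W V : nat -> 'M[R]_n).
Hypothesis W_consensus : finite_time_consensus tau W.
Hypothesis V_warm_up : warm_up tau V.
Context (alpha sigma : R).
Hypothesis alpha_gt0 : 0 < alpha.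
Context (dOm : measure_display) (Om : measurableType dOm) (P : probability Om R).
Context (x g N : nat -> Om -> 'M[R]_(n, d)).
Let G k w := local_grad f (x k w) + N k w.
Hypothesis xS : forall w k,
  x k.+1 w = V k.+1 *m (W (k %% tau)%N *m (x k w - alpha *: g k w)).
Hypothesis g0 : forall w, g 0%N w = V 0%N *m G 0%N w.
Hypothesis gS : forall w k,
  g k.+1 w = V k.+1 *m (W (k %% tau)%N *m g k w + G k.+1 w - G k w).
Hypothesis x_consensus :
  {ae P, forall w, forall k, (k <= tau)%N -> deviation (x k w) = 0}.
Hypothesis mx : forall k, measurable_mx (x k).
Hypothesis N_L2 : forall k, mx_L2 P (N k).
Hypothesis N_sum : forall m K (M : 'I_K -> 'M[R]_(m, n)),
  \int[P]_w sqnorm (\sum_(p < K) M p *m N p w) <=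
  sigma ^+ 2 * \sum_(p < K) sqnorm (M p).
Hypothesis N_avg : forall k, \int[P]_w sqnorm (avg (N k w)) <= sigma ^+ 2 / n%:R.
Hypothesis N_mean0 : forall k (h : 'M[R]_(n, d) -> 'rV[R]_d),
  (forall dB (B : measurableType dB) (X : B -> 'M[R]_(n, d)),
    measurable_mx X -> measurable_mx (fun b => h (X b))) ->
  mx_L2 P (fun w => h (x k w)) ->
  \int[P]_w inner (h (x k w)) (avg (N k w)) = 0.
Hypothesis gap0_integrable :
  rv_integrable P (fun w => mean_fun f (avg (x 0%N w)) - fmin).

Let dev k w := deviation (x k w).
Let mgrad k w := mean_grad f (x k w).
Let fgrad k w := grad (mean_fun f) (avg (x k w)).
Let gap k w := mean_fun f (avg (x k w)) - fmin.

(** The average of [g] equals that of the stochastic gradients at every step, since the increments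
    telescope and all mixing and warm-up matrices preserve averages. *)
Lemma avg_x_step w k :
  avg (x k.+1 w) = avg (x k w) - alpha *: (mgrad k w + avg (N k w)).
Proof.
have ag j : avg (g j w) = avg (G j w).
  elim: j => [|j IH].
    by rewrite g0 avg_doubly_stochastic//; exact: doubly_stochastic_warm_up V_warm_up _.
  rewrite gS avg_doubly_stochastic; last exact: doubly_stochastic_warm_up V_warm_up _.
  rewrite avgB avgD avg_doubly_stochastic; last exact: doubly_stochastic_mod.
  by rewrite IH addrAC subrr add0r.
rewrite xS !avg_doubly_stochastic ?avgB ?avgZ ?ag; last 2 first.
- exact: doubly_stochastic_mod.
- exact: doubly_stochastic_warm_up V_warm_up _.
by rewrite /G avgD /mgrad mean_gradE.
Qed.

(** For the noise the weight is part of the kernel, so that it gets squared in the variance; in the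
    gradient sum it stays outside, as a Jensen weight. *)
Let kernel k p := (weight tau k p)%:R *: dev_kernel tau W V k p.

Lemma dev_formula : {ae P, forall w, forall K k, (k <= K)%N -> dev k w =
  - alpha *: (\sum_(p < K) (weight tau k p)%:R *: (dev_kernel tau W V k p *m
      (local_grad f (x p.+1 w) - local_grad f (x p w)))
    + (\sum_(p < K) kernel k p *m N p.+1 w - \sum_(p < K) kernel k p *m N p w))}.
Proof.
apply: filterS x_consensus => w xc K k kK.
rewrite /dev (deviation_unroll n_gt0 tau_gt0 W_consensus V_warm_up (lt0r_neq0 alpha_gt0)
  (xS w) (e := fun k => G k.+1 w - G k w) _ xc kK); last first.
  by move=> l; rewrite gS -addrA.
congr (_ *: _); rewrite -sumrB -big_split; apply: eq_bigr => p _ /=.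
rewrite /kernel -!scalemxAl -!scalerBr -scalerDr -mulmxBr -mulmxDr.
by congr (_ *: (_ *m _)); rewrite /G opprD addrACA.
Qed.

Lemma mx_local_grad k : measurable_mx (fun w => local_grad f (x k w)).
Proof.
move=> i j; under eq_fun do rewrite mxE.
exact: (measurable_grad_const (measurable_mx_row i (mx k)) (f_differentiable i)).
Qed.

Lemma measurable_mean_grad dB (B : measurableType dB) (X : B -> 'M[R]_(n, d)) :
  measurable_mx X -> measurable_mx (fun b => mean_grad f (X b)).
Proof.
move=> mX; under eq_fun do rewrite mean_gradE.
apply: measurable_avg => i j; under eq_fun do rewrite mxE.
exact: (measurable_grad_const (measurable_mx_row i mX) (f_differentiable i)).
Qed.

Lemma measurable_grad_mean dB (B : measurableType dB) (X : B -> 'M[R]_(n, d)) :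
  measurable_mx X -> measurable_mx (fun b => grad (mean_fun f) (avg (X b))).
Proof.
move=> mX; apply: measurable_grad_const; first exact: measurable_avg.
exact: differentiable_mean_fun.
Qed.

Lemma measurable_gap k : measurable_fun setT (gap k).
Proof.
apply: measurable_funB => //.
apply: (measurable_continuous_row (measurable_avg (mx k) 0)) => z.
exact/differentiable_continuous/differentiable_mean_fun.
Qed.

Lemma gap_ge0 k w : 0 <= gap k w.
Proof. by rewrite subr_ge0. Qed.

Lemma fgrad_gap k w : sqnorm (fgrad k w) <= 2 * L * gap k w.
Proof.
apply: sqnorm_grad_le => //; first exact: differentiable_mean_fun.
exact: grad_mean_fun_lipschitz.
Qed.

Lemma gap_step k w : gap k.+1 w <= gap k w
  - alpha * inner (fgrad k w) (mgrad k w + avg (N k w))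
  + L / 2 * (alpha ^+ 2 * sqnorm (mgrad k w + avg (N k w))).
Proof.
rewrite /gap avg_x_step -scaleNr.
have := descent_lemma L_gt0 (differentiable_mean_fun f_differentiable)
  (grad_mean_fun_lipschitz n_gt0 f_differentiable L_gt0 grad_f_lipschitz) (avg (x k w))
  (- alpha *: (mgrad k w + avg (N k w))).
by rewrite innerZr sqnormZ sqrrN /fgrad; lra.
Qed.

Lemma rv_integrable_ae (X Y : Om -> R) : measurable_fun setT X -> rv_integrable P Y ->
  {ae P, forall w, X w = Y w} -> rv_integrable P X.
Proof.
move=> mX hY XY; apply/integrableP; split; first exact/measurable_EFinP.
rewrite (ae_eq_integral (fun w => `|(Y w)%:E|%E)) //.
- by case/integrableP : hY.
- by apply: measurableT_comp => //; exact/measurable_EFinP.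
- by apply: measurableT_comp => //; exact: (measurable_int P).
- by apply: filterS XY => w /= -> _.
Qed.

Definition regular k := [/\ mx_L2 P (dev k), mx_L2 P (fgrad k) & rv_integrable P (gap k)].

Lemma regular_fgrad k : rv_integrable P (gap k) -> mx_L2 P (fgrad k).
Proof.
move=> ig; split; first exact: measurable_grad_mean.
apply: (rv_integrable_le _ (rv_integrableZ (2 * L) ig)).
  exact/measurable_sqnorm/measurable_grad_mean.
by move=> w; rewrite ger0_norm ?sqnorm_ge0// fgrad_gap.
Qed.

(** The mean gradient is reached through [fgrad], from which it differs by at most a multiple of the
    deviation. *)
Lemma regular_mgrad k : regular k -> mx_L2 P (mgrad k).
Proof.
move=> [hdev hg _].
rewrite (_ : mgrad k = fun w => (mgrad k w - fgrad k w) + fgrad k w); last first.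
  by apply/funext => w; rewrite subrK.
apply: mx_L2D => //.
apply: (mx_L2_le (c := L ^+ 2 / n%:R) _ hdev).
  by apply: measurable_mxB; [exact: measurable_mean_grad|exact: measurable_grad_mean].
move=> w; have := mean_grad_dist n_gt0 f_differentiable L_gt0 grad_f_lipschitz (x k w).
by move=> H; rewrite mulrAC ler_pdivlMr ?ltr0n// mulrC.
Qed.

Lemma x_diff_sqnorm k w : sqnorm (x k.+1 w - x k w) =
  sqnorm (dev k.+1 w - dev k w)
  + n%:R * (alpha ^+ 2 * sqnorm (mgrad k w + avg (N k w))).
Proof.
rewrite (sqnorm_split _ n_gt0) deviationB avgB avg_x_step.
by rewrite (addrAC (avg (x k w))) subrr sub0r sqnormN sqnormZ.
Qed.

Lemma mx_L2_x_diff k : regular k -> mx_L2 P (dev k.+1) ->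
  mx_L2 P (fun w => x k.+1 w - x k w).
Proof.
move=> rk hdev; have [hdevk _ _] := rk.
split; first exact: measurable_mxB.
under eq_fun do rewrite x_diff_sqnorm.
apply: rv_integrableD; first by have [] := mx_L2B hdev hdevk.
apply/rv_integrableZ/rv_integrableZ.
by have [] := mx_L2D (regular_mgrad rk) (mx_L2_avg n_gt0 (N_L2 k)).
Qed.

Lemma mx_L2_local_grad_diff k : regular k -> mx_L2 P (dev k.+1) ->
  mx_L2 P (fun w => local_grad f (x k.+1 w) - local_grad f (x k w)).
Proof.
move=> rk hdev; apply: (mx_L2_le (c := L ^+ 2) _ (mx_L2_x_diff rk hdev)).
  by apply: measurable_mxB; exact: mx_local_grad.
by move=> w; exact: local_grad_lipschitz.
Qed.

Lemma mx_L2_kernel k p (X : Om -> 'M[R]_(n, d)) : mx_L2 P X ->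
  mx_L2 P (fun w => kernel k p *m X w).
Proof.
move=> hX; rewrite (_ : (fun w => _) = fun w =>
    (weight tau k p)%:R *: (dev_kernel tau W V k p *m X w)).
  by apply/mx_L2Z/mx_L2_nonexpansive => //; exact: nonexpansive_dev_kernel.
by apply/funext => w; rewrite scalemxAl.
Qed.

(* Integrability of the objective gap is only assumed at [x 0]; individual local
   gradients need not be square integrable, only their differences are. *)
Lemma regular_all k : regular k.
Proof.
have aeX k' (X : Om -> 'M[R]_(n, d)) : mx_L2 P X ->
    {ae P, forall w, dev k' w = X w} -> mx_L2 P (dev k').
  move=> [mX iX] h; split; first exact: measurable_deviation.
  apply: (rv_integrable_ae _ iX).
    exact/measurable_sqnorm/measurable_deviation.
  by apply: filterS h => w ->.
elim/ltn_ind: k => -[_|k IH].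
  have hdev : mx_L2 P (dev 0%N).
    apply: (aeX _ _ (mx_L2_0 P _ _)).
    by apply: filterS x_consensus => w h; exact: h.
  by split=> //; exact: regular_fgrad.
have rk := IH k (ltnSn k).
have hdev : mx_L2 P (dev k.+1).
  apply: (aeX _ (fun w => - alpha *: (\sum_(p < k) (weight tau k.+1 p)%:R *:
      (dev_kernel tau W V k.+1 p *m (local_grad f (x p.+1 w) - local_grad f (x p w)))
    + (\sum_(p < k.+1) kernel k.+1 p *m N p.+1 w - \sum_(p < k.+1) kernel k.+1 p *m N p w)))).
    apply: mx_L2Z; apply: mx_L2D; last first.
      by apply: mx_L2B; apply: mx_L2_sum => p; exact: mx_L2_kernel.
    apply: mx_L2_sum => p; apply/mx_L2Z/mx_L2_nonexpansive.
      exact: nonexpansive_dev_kernel.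
    apply: mx_L2_local_grad_diff; first by apply: IH; have := ltn_ord p; lia.
    by have [] := IH p.+1 (ltn_ord p).
  apply: filterS dev_formula => w /(_ k.+1 k.+1 (leqnn _)) ->.
  congr (_ *: (_ + _)); rewrite big_ord_recr /= (_ : weight _ _ _ = 0%N) ?scale0r ?addr0//.
  by rewrite /weight subnn; case: ifP.
have hgap : rv_integrable P (gap k.+1).
  have [_ hf hg] := rk; have hm := regular_mgrad rk.
  have hmN := mx_L2D hm (mx_L2_avg n_gt0 (N_L2 k)).
  apply: (rv_integrable_le _ (rv_integrableD (rv_integrableB hg
    (rv_integrableZ alpha (rv_integrable_inner hf hmN)))
    (rv_integrableZ (L / 2) (rv_integrableZ (alpha ^+ 2) hmN.2)))).
    exact: measurable_gap.
  by move=> w; rewrite ger0_norm ?gap_ge0// gap_step.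
by split=> //; exact: regular_fgrad.
Qed.

Let Edev k := \int[P]_w sqnorm (dev k w).
Let Emg k := \int[P]_w sqnorm (mgrad k w).
Let Efg k := \int[P]_w sqnorm (fgrad k w).
Let Egap k := \int[P]_w gap k w.

Lemma L2_dev k : mx_L2 P (dev k). Proof. by case: (regular_all k). Qed.
Lemma L2_fgrad k : mx_L2 P (fgrad k). Proof. by case: (regular_all k). Qed.
Lemma integrable_gap k : rv_integrable P (gap k). Proof. by case: (regular_all k). Qed.
Lemma L2_mgrad k : mx_L2 P (mgrad k).
Proof. exact/regular_mgrad/regular_all. Qed.
Lemma L2_avgN k : mx_L2 P (fun w => avg (N k w)).
Proof. exact: mx_L2_avg. Qed.

Lemma avg_grad_second_moment k :
  \int[P]_w sqnorm (mgrad k w + avg (N k w)) <= Emg k + sigma ^+ 2 / n%:R.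
Proof.
have i1 := (L2_mgrad k).2; have i3 := (L2_avgN k).2.
have i2 := rv_integrable_inner (L2_mgrad k) (L2_avgN k).
under eq_Rintegral do rewrite sqnormD.
rewrite Rintegral_add//; last by apply: rv_integrableD => //; exact: rv_integrableZ.
rewrite Rintegral_add//; last exact: rv_integrableZ.
rewrite RintegralZ// (N_mean0 (h := mean_grad f)) ?mulr0 ?addr0 ?lerD2l//.
  exact: measurable_mean_grad.
exact: L2_mgrad.
Qed.

(** The noise drops out of the inner product in expectation. Polarization turns the remaining
    product into half of both squared norms minus half of their squared distance, which
    [mean_grad_dist] bounds by the deviation. *)
Lemma expected_descent k : Egap k.+1 <= Egap k
  - alpha / 2 * (Efg k + Emg k - L ^+ 2 / n%:R * Edev k)
  + L / 2 * (alpha ^+ 2 * (Emg k + sigma ^+ 2 / n%:R)).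
Proof.
have hm := L2_mgrad k; have hf := L2_fgrad k; have hN := L2_avgN k.
have hmN := mx_L2D hm hN.
have ifm := rv_integrable_inner hf hm; have ifN := rv_integrable_inner hf hN.
have step : Egap k.+1 <= Egap k
    - alpha * \int[P]_w inner (fgrad k w) (mgrad k w)
    + L / 2 * (alpha ^+ 2 * \int[P]_w sqnorm (mgrad k w + avg (N k w))).
  have igk := integrable_gap k.
  have i1 := rv_integrableZ alpha (rv_integrable_inner hf hmN).
  have i2 := rv_integrableZ (L / 2) (rv_integrableZ (alpha ^+ 2) hmN.2).
  apply: le_trans (Rintegral_le (integrable_gap k.+1)
    (rv_integrableD (rv_integrableB igk i1) i2) (gap_step k)) _.
  rewrite Rintegral_add//; last exact: rv_integrableB.
  rewrite (Rintegral_sub igk i1).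
  rewrite (RintegralZ _ (rv_integrableZ (alpha ^+ 2) hmN.2)) (RintegralZ _ hmN.2).
  rewrite (RintegralZ _ (rv_integrable_inner hf hmN)).
  under [X in _ - alpha * X]eq_Rintegral do rewrite innerDr.
  rewrite Rintegral_add// (N_mean0 (h := fun X => grad (mean_fun f) (avg X))) ?addr0//.
  exact: measurable_grad_mean.
have polar : Efg k + Emg k - L ^+ 2 / n%:R * Edev k <=
    2 * \int[P]_w inner (fgrad k w) (mgrad k w).
  have ifm2 := rv_integrableD hf.2 hm.2.
  have idev := rv_integrableZ (L ^+ 2 / n%:R) (L2_dev k).2.
  have := Rintegral_le (rv_integrableB ifm2 idev) (rv_integrableZ 2 ifm).
  rewrite (Rintegral_sub ifm2 idev) (Rintegral_add hf.2 hm.2).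
  rewrite (RintegralZ _ (L2_dev k).2) (RintegralZ _ ifm); apply.
  move=> w; have := mean_grad_dist n_gt0 f_differentiable L_gt0 grad_f_lipschitz (x k w).
  move=> H; have : sqnorm (mgrad k w - fgrad k w) <= L ^+ 2 / n%:R * sqnorm (dev k w).
    by rewrite mulrAC ler_pdivlMr ?ltr0n// mulrC.
  by rewrite sqnormB innerC; lra.
have := avg_grad_second_moment k => h2.
have a2 : 0 <= alpha / 2 by rewrite divr_ge0 ?ltW.
have p1 := ler_wpM2l a2 polar.
have c0 : 0 <= L / 2 * alpha ^+ 2 by rewrite mulr_ge0 ?sqr_ge0// divr_ge0 ?ltW.
have p2 := ler_wpM2l c0 h2.
move: step p1 p2; set I1 := \int[P]_w inner _ _; set I2 := \int[P]_w sqnorm (_ + _).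
rewrite !mulrA; lra.
Qed.

Let Edg k := \int[P]_w sqnorm (local_grad f (x k.+1 w) - local_grad f (x k w)).

Lemma L2_local_grad_diff k :
  mx_L2 P (fun w => local_grad f (x k.+1 w) - local_grad f (x k w)).
Proof. exact: mx_L2_local_grad_diff (regular_all k) (L2_dev k.+1). Qed.

Lemma local_grad_diff_moment k : Edg k <= L ^+ 2 *
  (2 * Edev k.+1 + 2 * Edev k + n%:R * alpha ^+ 2 * (Emg k + sigma ^+ 2 / n%:R)).
Proof.
have hmN := mx_L2D (L2_mgrad k) (L2_avgN k).
have i1 := rv_integrableD (rv_integrableZ 2 (L2_dev k.+1).2) (rv_integrableZ 2 (L2_dev k).2).
have i2 := rv_integrableZ (n%:R * alpha ^+ 2) hmN.2.
have i3 := rv_integrableZ (L ^+ 2) (rv_integrableD i1 i2).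
apply: (@le_trans _ _ (\int[P]_w (L ^+ 2 * (2 * sqnorm (dev k.+1 w) + 2 * sqnorm (dev k w)
    + n%:R * alpha ^+ 2 * sqnorm (mgrad k w + avg (N k w)))))).
  apply: Rintegral_le => //; first exact: (L2_local_grad_diff k).2.
  move=> w; apply: le_trans (local_grad_lipschitz L_gt0 grad_f_lipschitz _ _) _.
  by rewrite ler_wpM2l ?sqr_ge0// x_diff_sqnorm mulrA lerD2r sqnormB_le.
rewrite (RintegralZ _ (rv_integrableD i1 i2)) ler_wpM2l ?sqr_ge0//.
rewrite (Rintegral_add i1 i2) (RintegralZ _ hmN.2) (Rintegral_add
  (rv_integrableZ 2 (L2_dev k.+1).2) (rv_integrableZ 2 (L2_dev k).2)).
rewrite (RintegralZ _ (L2_dev k.+1).2) (RintegralZ _ (L2_dev k).2) lerD2l.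
by rewrite ler_wpM2l ?avg_grad_second_moment// mulr_ge0 ?sqr_ge0.
Qed.

Lemma kernel_sqnorm_sum K k :
  \sum_(p < K) sqnorm (kernel k p) <= 4 * tau%:R ^+ 3 * n%:R.
Proof.
apply: (@le_trans _ _ (\sum_(p < K) (weight tau k p)%:R ^+ 2 * n%:R)).
  apply: ler_sum => p _; rewrite sqnormZ ler_wpM2l ?sqr_ge0//.
  by apply: sqnorm_nonexpansive; exact: nonexpansive_dev_kernel.
rewrite -mulr_suml ler_wpM2r//.
under eq_bigr do rewrite -natrX.
by rewrite -natr_sum -natrX -natrM ler_nat sum_sqr_weight.
Qed.

Lemma noise_kernel_moment K k :
  \int[P]_w sqnorm (\sum_(p < K) kernel k p *m N p w) <=
    sigma ^+ 2 * (4 * tau%:R ^+ 3 * n%:R) /\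
  \int[P]_w sqnorm (\sum_(p < K) kernel k p *m N p.+1 w) <=
    sigma ^+ 2 * (4 * tau%:R ^+ 3 * n%:R).
Proof.
have H := kernel_sqnorm_sum K k.
split; first by apply: le_trans (N_sum _) _; rewrite ler_wpM2l ?sqr_ge0.
(* A zero coefficient at step [0] shifts the sum, so that [N_sum] covers the noises [N p.+1]. *)
pose M (p : 'I_K.+1) := if p : nat is p'.+1 then kernel k p' else 0.
have := N_sum M; rewrite big_ord_recl sqnorm0 add0r => H1.
rewrite (_ : \int[P]_w _ = \int[P]_w sqnorm (\sum_(p < K.+1) M p *m N p w)).
  by apply: le_trans H1 _; rewrite ler_wpM2l ?sqr_ge0.
apply: eq_Rintegral => w _; rewrite big_ord_recl mul0mx add0r.
by congr sqnorm; apply: eq_bigr.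
Qed.

(** The gradient part carries [2] from splitting the square and [2 * tau ^ 2] from Jensen with the
    row sum. Each of the two noise sums carries [4 * (4 * tau ^ 3 * n * sigma ^ 2)], together [32];
    they are separated because the noises are uncorrelated within each sum. *)
Lemma dev_moment K k : (k <= K)%N -> Edev k <=
  4 * alpha ^+ 2 * tau%:R ^+ 2 * \sum_(p < K) (weight tau k p)%:R * Edg p
  + 32 * alpha ^+ 2 * tau%:R ^+ 3 * n%:R * sigma ^+ 2.
Proof.
move=> kK.
have iS : rv_integrable P (fun w => \sum_(p < K) (weight tau k p)%:R *
    sqnorm (local_grad f (x p.+1 w) - local_grad f (x p w))).
  by apply: rv_integrable_sum => p; exact: rv_integrableZ _ (L2_local_grad_diff p).2.
have B1 : mx_L2 P (fun w => \sum_(p < K) kernel k p *m N p.+1 w).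
  by apply: mx_L2_sum => p; exact: mx_L2_kernel.
have B2 : mx_L2 P (fun w => \sum_(p < K) kernel k p *m N p w).
  by apply: mx_L2_sum => p; exact: mx_L2_kernel.
have i1 := rv_integrableZ (4 * alpha ^+ 2 * tau%:R ^+ 2) iS.
have i2 := rv_integrableZ (4 * alpha ^+ 2) B1.2.
have i3 := rv_integrableZ (4 * alpha ^+ 2) B2.2.
have := Rintegral_le_ae (L2_dev k).2 (rv_integrableD (rv_integrableD i1 i2) i3).
rewrite (Rintegral_add (rv_integrableD i1 i2) i3) (Rintegral_add i1 i2).
rewrite (RintegralZ _ iS) (RintegralZ _ B1.2) (RintegralZ _ B2.2).
have -> : \int[P]_w (\sum_(p < K) (weight tau k p)%:R *
      sqnorm (local_grad f (x p.+1 w) - local_grad f (x p w))) =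
    \sum_(p < K) (weight tau k p)%:R * Edg p.
  rewrite Rintegral_sum => [|p]; last exact: rv_integrableZ _ (L2_local_grad_diff p).2.
  by apply: eq_bigr => p _; rewrite (RintegralZ _ (L2_local_grad_diff p).2).
move=> H; apply: le_trans (H _) _; last first.
  have [h1 h2] := noise_kernel_moment K k.
  have a0 : 0 <= 4 * alpha ^+ 2 by rewrite mulr_ge0 ?sqr_ge0.
  have := ler_wpM2l a0 h1; have := ler_wpM2l a0 h2; lra.
apply: filterS dev_formula => w /(_ K k kK) ->.
set A := \sum_(p < K) _ *: _; set C1 := \sum_(p < K) _ *m N p.+1 w.
set C2 := \sum_(p < K) _ *m N p w; set SS := \sum_(p < K) _ * _.
have hA : sqnorm A <= 2 * tau%:R ^+ 2 * SS.
  have w0 (p : 'I_K) : 0 <= (weight tau k p)%:R :> R by [].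
  apply: le_trans (sqnorm_wsum_le _ _ w0) _.
  apply: ler_pM; [exact: sumr_ge0| | |].
  - by apply: sumr_ge0 => p _; rewrite mulr_ge0 ?sqnorm_ge0.
  - by rewrite -natr_sum -natrX -natrM ler_nat sum_weight_l.
  - apply: ler_sum => p _; rewrite ler_wpM2l//.
    exact: nonexpansive_dev_kernel.
have h1 := sqnormD_le A (C1 - C2); have h2 := sqnormB_le C1 C2.
rewrite sqnormZ sqrrN.
have h3 : sqnorm (A + (C1 - C2)) <=
    4 * tau%:R ^+ 2 * SS + 4 * sqnorm C1 + 4 * sqnorm C2 by lra.
have := ler_wpM2l (sqr_ge0 alpha) h3; lra.
Qed.

Hypothesis alpha_small : 96 * (alpha ^+ 2 * L ^+ 2 * tau%:R ^+ 4) <= 1.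

Lemma convergence_bound K :
  alpha / 4 * \sum_(k < K.+1) (\int[P]_w sqnorm (mean_grad f (x k w))
    + \int[P]_w sqnorm (grad (mean_fun f) (avg (x k w)))) <=
  \int[P]_w (mean_fun f (avg (x 0%N w)) - fmin)
  + K.+1%:R * (25 * (alpha ^+ 3 * (tau%:R ^+ 3 * L ^+ 2 * sigma ^+ 2))
    + alpha ^+ 2 * (L * sigma ^+ 2 / n%:R) / 2).
Proof.
have pos (X : nat -> Om -> R) k : (forall k w, 0 <= X k w) -> 0 <= \int[P]_w X k w.
  by move=> X0; exact: Rintegral_ge0T.
exact: (sum_grad_bound n_gt0 tau_gt0 alpha_gt0 L_gt0 alpha_small
  (fun k => pos _ k (fun k w => sqnorm_ge0 (dev k w)))
  (fun k => pos _ k (fun k w => sqnorm_ge0 (mgrad k w)))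
  (fun k => pos _ k (fun k w => sqnorm_ge0 _))
  dev_moment local_grad_diff_moment
  (fun k => pos _ k (fun k w => sqnorm_ge0 (fgrad k w)))
  (fun k => pos _ k gap_ge0) expected_descent K).
Qed.

Lemma grads_integrable k :
  rv_integrable P (fun w => sqnorm (mean_grad f (x k w))) /\
  rv_integrable P (fun w => sqnorm (grad (mean_fun f) (avg (x k w)))).
Proof. by split; [exact: (L2_mgrad k).2|exact: (L2_fgrad k).2]. Qed.

End convergence.

(** A vanishing sum of nonnegative expectations makes each term vanish, hence each deviation almost
    surely; finitely many null sets are then merged. *)
Lemma consensus_ae (R : realType) (n d tau : nat) (dOm : measure_display)
    (Om : measurableType dOm) (P : probability Om R) (x : nat -> Om -> 'M[R]_(n, d)) :
  (forall k, measurable_mx (x k)) ->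
  (\sum_(k < tau.+1) 'E_P[fun w => (enorm (deviation (x k w)) ^+ 2)%R] = 0)%E ->
  {ae P, forall w, forall k, (k <= tau)%N -> deviation (x k w) = 0}.
Proof.
move=> mx /eqP; rewrite seq_psume_eq0 => [/allP h|k _]; last first.
  by apply: expectation_ge0 => w; exact: sqr_ge0.
suff H (k : 'I_tau.+1) : {ae P, forall w, deviation (x k w) = 0}.
  apply: filterS (filter_forall _ H) => w hw k kt.
  by have := hw (Ordinal (kt : (k < tau.+1)%N)).
have := h k (mem_index_enum _) => /= /eqP; rewrite unlock => E0.
have mD : measurable_fun setT (EFin \o (fun w => sqnorm (deviation (x k w)))).
  exact/measurable_EFinP/measurable_sqnorm/measurable_deviation.
have /(ae_eq_integral_abs P measurableT mD) : (\int[P]_w `|(sqnorm (deviation (x k w)))%:E| = 0)%E.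
  rewrite -E0; apply: eq_integral => w _.
  by rewrite enorm_sqr gee0_abs// lee_fin sqnorm_ge0.
by apply: filterS => w /(_ I)[/sqnorm_eq0].
Qed.

Theorem corollary5p4 (R : realType) (Delta : R) :
  exists gamma6 gamma7 gamma8 : R,
  [/\ 0 < gamma6, 0 < gamma7, 0 < gamma8 &
  forall (n d tau : nat) (n_gt0 : (0 < n)%N) (tau_gt0 : (0 < tau)%N)
    (* the objective: f_i(x) = E[F_i(x; zeta_i)], zeta_i defined on (Ospace_i, Q_i) *)
    (dO : 'I_n -> measure_display) (Ospace : forall i, measurableType (dO i))
    (Q : forall i, probability (Ospace i) R)
    (dS : 'I_n -> measure_display) (Sspace : forall i, measurableType (dS i))
    (zeta : forall i, {RV (Q i) >-> Sspace i})
    (F : forall i, 'rV[R]_d -> Sspace i -> R) (f : 'I_n -> 'rV[R]_d -> R)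
    (F_measurable : forall i x, measurable_fun setT (F i x))
    (F_differentiable : forall i s (x : 'rV[R]_d), differentiable (F i ^~ s) x)
    (F_integrable : forall i x,
       (Q i).-integrable setT (EFin \o (F i x \o zeta i)))
    (fE : forall i x, ('E_(Q i)[F i x \o zeta i] = (f i x)%:E)%E)
    (f_differentiable : forall i (x : 'rV[R]_d), differentiable (f i) x)
    (grad_f_continuous : forall i, continuous (grad (f i)))
    (L : R) (L_gt0 : 0 < L)
    (grad_f_lipschitz : forall i x y,
       enorm (grad (f i) x - grad (f i) y) <= L * enorm (x - y))
    (f_bounded_below : has_lbound (range (mean_fun f)))
    (sigma : R) (sigma_gt0 : 0 < sigma)
    (W : nat -> 'M[R]_n) (W_consensus : finite_time_consensus tau W)
    (T : nat) (T_ge : (tau <= T)%N),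
  let fstar := inf (range (mean_fun f)) in
  let c1 := L * sigma ^+ 2 / n%:R in
  let c2 := tau%:R ^+ 3 * L ^+ 2 * sigma ^+ 2 in
  let alpha :=
    Num.min ((c1 * T%:R)^-1 `^ 2^-1)
      (Num.min ((c2 * T%:R)^-1 `^ 3^-1)
               (4 * Num.sqrt 6 * tau%:R ^+ 2 * L)^-1) in
  forall (dOm : measure_display) (Om : measurableType dOm)
    (P : probability Om R)
    (* the samples xi k i of agent i at step k, and the iterates *)
    (xi : nat -> forall i, {RV P >-> Sspace i})
    (V : nat -> 'M[R]_n)
    (x g : nat -> Om -> 'M[R]_(n, d))
    (x0_measurable : forall i j, measurable_fun setT (fun w => x 0%N w i j))
    (xi_independent :
       mutually_independent P
         (fun ki : nat * 'I_n => sigma_of (xi ki.1 ki.2)))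
    (x0_xi_independent :
       independent_events P
         <<s coord_events (x 0%N) >>
         <<s \bigcup_(ki in [set: nat * 'I_n]) sigma_of (xi ki.1 ki.2) >>)
    (V_warm_up : warm_up tau V)
    (xg_gtft : forall w,
       gtft tau W V alpha (fun k => stoch_grad F (fun i => xi k i w))
         (fun k => x k w) (fun k => g k w))
    (unbiased : forall k i j,
       is_cond_exp P (history x k)
         (fun w => grad (fun y => F i y (xi k i w)) (row i (x k w)) 0 j)
         (fun w => grad (f i) (row i (x k w)) 0 j))
    (bounded_variance : forall k i,
       cond_exp_le P (history x k)
         (fun w => enorm (grad (fun y => F i y (xi k i w)) (row i (x k w))
                          - grad (f i) (row i (x k w))) ^+ 2)
         (sigma ^+ 2))
    (initial_gap :
       ('E_P[fun w => (mean_fun f (avg (x 0%N w)) - fstar)%R] = Delta%:E)%E)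
    (first_period_consensus :
       (\sum_(k < tau.+1) 'E_P[fun w => (enorm (deviation (x k w)) ^+ 2)%R] = 0)%E),
  ((T.+1%:R^-1)%:E *
     \sum_(k < T.+1) ('E_P[fun w => (enorm (mean_grad f (x k w)) ^+ 2)%R] +
                      'E_P[fun w => (enorm (grad (mean_fun f) (avg (x k w))) ^+ 2)%R])
   <= (gamma6 * tau%:R ^+ 2 * L / T%:R
       + gamma7 * tau%:R * (L * sigma / T%:R) `^ (2 / 3)
       + gamma8 * (L * sigma ^+ 2 / (n%:R * T%:R)) `^ 2^-1)%:E)%E].
Proof.
(* These are the constants of [rate_bound] at [|Delta| + 1]. The constants are fixed before anything
   is known about the sign of [Delta], hence the absolute value; adding 1 keeps the first one
   positive when [Delta = 0]. *)
exists (16 * Num.sqrt 6 * (`|Delta| + 1)), (4 * (`|Delta| + 1) + 100),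
  (4 * (`|Delta| + 1) + 2).
have D1 : 0 < `|Delta| + 1 by rewrite ltr_wpDl.
split; [by rewrite !mulr_gt0// sqrtr_gt0|lra|lra|].
move=> n d tau n_gt0 tau_gt0 dO Ospace Q dS Sspace zeta F f F_measurable
  F_differentiable F_integrable fE f_differentiable grad_f_continuous L L_gt0
  grad_f_lipschitz f_bounded_below sigma sigma_gt0 W W_consensus T T_ge
  fstar c1 c2 alpha dOm Om P xi V x g x0_measurable xi_independent
  x0_xi_independent V_warm_up xg_gtft unbiased bounded_variance initial_gap
  first_period_consensus.
have T_gt0 : (0 < T)%N by exact: leq_trans T_ge.
have alphaE : alpha = stepsize n tau T L sigma by [].
have mx := measurable_x F_measurable F_differentiable x0_measurable xg_gtft.
have fmin_le y : fstar <= mean_fun f y by apply: ge_inf => //; exists y.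
pose N := noise F f xi x.
have GE k w : local_grad f (x k w) + N k w = stoch_grad F (fun i => xi k i w) (x k w).
  by rewrite addrC subrK.
(* The gap is nonnegative, so the finite expectation [Delta] gives integrability. *)
have gap0 : rv_integrable P (fun w => mean_fun f (avg (x 0%N w)) - fstar).
  have m0 : measurable_fun setT (fun w => mean_fun f (avg (x 0%N w)) - fstar).
    apply: measurable_funB => //.
    apply: (measurable_continuous_row (measurable_avg (mx 0%N) 0)) => z.
    exact/differentiable_continuous/differentiable_mean_fun.
  apply/integrableP; split; first exact/measurable_EFinP.
  under eq_integral => w _ do rewrite gee0_abs ?lee_fin ?subr_ge0//.
  by move: initial_gap; rewrite unlock => ->; exact: ltry.
have xS w k : x k.+1 w = V k.+1 *m (W (k %% tau)%N *m (x k w - alpha *: g k w)).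
  by have [_ /(_ k)[]] := xg_gtft w.
have g0 w : g 0%N w = V 0%N *m (local_grad f (x 0%N w) + N 0%N w).
  by rewrite GE; have [] := xg_gtft w.
have gS w k : g k.+1 w = V k.+1 *m (W (k %% tau)%N *m g k w
    + (local_grad f (x k.+1 w) + N k.+1 w) - (local_grad f (x k w) + N k w)).
  by rewrite !GE; have [_ /(_ k)[]] := xg_gtft w.
have alpha_gt0 : 0 < alpha by rewrite alphaE stepsize_gt0.
have xc := consensus_ae mx first_period_consensus.
have N_L2 := mx_L2_noise unbiased bounded_variance.
have N_sum := noise_sum_variance F_measurable F_differentiable f_differentiable
  x0_measurable xi_independent x0_xi_independent xg_gtft unbiased bounded_variance.
have N_avg := avg_noise_variance F_measurable F_differentiable f_differentiable
  x0_measurable xi_independent x0_xi_independent xg_gtft unbiased bounded_variance n_gt0.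
have N_mean0 := avg_noise_mean0 F_measurable F_differentiable f_differentiable
  x0_measurable xi_independent x0_xi_independent xg_gtft unbiased bounded_variance.
have ints := grads_integrable n_gt0 tau_gt0 f_differentiable L_gt0 grad_f_lipschitz
  fmin_le W_consensus V_warm_up alpha_gt0 xS g0 gS xc mx N_L2 gap0.
have alpha_small : 96 * (alpha ^+ 2 * L ^+ 2 * tau%:R ^+ 4) <= 1.
  by rewrite alphaE; exact: stepsize_small.
have bound := convergence_bound n_gt0 tau_gt0 f_differentiable L_gt0 grad_f_lipschitz
  fmin_le W_consensus V_warm_up alpha_gt0 xS g0 gS xc mx N_L2 N_sum N_avg N_mean0
  gap0 alpha_small T.
have gap0E : \int[P]_w (mean_fun f (avg (x 0%N w)) - fstar) = Delta.
  by have := expectationE gap0; rewrite initial_gap => -[].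
have E1 k : ('E_P[fun w => (enorm (mean_grad f (x k w)) ^+ 2)%R] =
    (\int[P]_w sqnorm (mean_grad f (x k w)))%:E)%E.
  rewrite -expectationE; last by have [] := ints k.
  by congr expectation; apply/funext => w; rewrite enorm_sqr.
have E2 k : ('E_P[fun w => (enorm (grad (mean_fun f) (avg (x k w))) ^+ 2)%R] =
    (\int[P]_w sqnorm (grad (mean_fun f) (avg (x k w))))%:E)%E.
  rewrite -expectationE; last by have [] := ints k.
  by congr expectation; apply/funext => w; rewrite enorm_sqr.
under eq_bigr do rewrite E1 E2 -EFinD.
rewrite sumEFin -EFinM lee_fin.
apply: (rate_bound n_gt0 tau_gt0 T_gt0 L_gt0 sigma_gt0 (gap0 := Delta)).
  by rewrite lerDl.
by rewrite -alphaE -{1}gap0E; exact: bound.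
Qed.
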